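(* Let $\tau_L,\delta_L,\tau_R,\delta_R\in\mathbb{R}$ and $\mu\neq 0$, and let $f$ be the two-dimensional border-collision normal form with these parameters. Let $\mathcal{X}$ and $\mathcal{Y}$ be words in the symbols $L,R$, with $\mathcal{X}$ primitive and $\mathcal{X}_0\neq\mathcal{Y}_0$, and let $\mathcal{S}[k]=\mathcal{X}^k\mathcal{Y}$. Suppose there exist infinitely many values of $k\ge 1$ for which $f$ exhibits a unique, admissible, stable $\mathcal{S}[k]$-cycle that has no points on the switching manifold $x=0$. Suppose $\lambda_1$ and $\lambda_2$ are the eigenvalues of $M_{\mathcal{X}}$, where $0\le\lambda_1<1<\lambda_2$, and that the $v$-axis is not parallel to the switching manifold $x=0$. Then: (i) $g^{\mathcal{Y}}$ maps the $v$-axis to the $u$-axis; (ii) $\lambda_1\neq 0$ and $\lambda_2=\frac{1}{\lambda_1}$; (iii) the $\mathcal{X}$-cycle is admissible, and the $\mathcal{S}[k]$-cycles limit to an orbit that is homoclinic to the $\mathcal{X}$-cycle as $k\to\infty$.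
   Context: The two-dimensional border-collision normal form is the continuous map $f:\mathbb{R}^2\to\mathbb{R}^2$, $f(x,y)=f^L(x,y)$ if $x\le 0$ and $f(x,y)=f^R(x,y)$ if $x\ge 0$, where for $J\in\{L,R\}$ $$f^J(x,y)=A_J\begin{bmatrix} x \\ y \end{bmatrix}+\begin{bmatrix} 1 \\ 0 \end{bmatrix}\mu,\qquad A_J=\begin{bmatrix} \tau_J & 1 \\ -\delta_J & 0 \end{bmatrix}.$$ The line $x=0$ is the switching manifold. Words and symbol sequences. A word $\mathcal{W}=\mathcal{W}_0\cdots\mathcal{W}_{n-1}$ in $\{L,R\}$ is primitive if it is not a power $\mathcal{V}^m$, $m\ge2$, of a shorter word. A word is identified with the periodic symbol sequence $\mathbb{Z}\to\{L,R\}$ obtained by repeating it infinitely. $n_{\mathcal{W}}$ denotes the length of $\mathcal{W}$. $\mathcal{X}^k\mathcal{Y}$ denotes $k$ copies of $\mathcal{X}$ followed by $\mathcal{Y}$. For a word $\mathcal{S}$ of length $n$, $f^{\mathcal{S}}=f^{\mathcal{S}_{n-1}}\circ\cdots\circ f^{\mathcal{S}_0}$, an affine map with matrix part $M_{\mathcal{S}}=A_{\mathcal{S}_{n-1}}\cdots A_{\mathcal{S}_0}$. Cycles. An $\mathcal{S}$-cycle is a tuple of points $(x_i,y_i)$, $i$ modulo $n$, with $(x_{i+1},y_{i+1})=f^{\mathcal{S}_i}(x_i,y_i)$ for all $i$; it is determined by $(x_0,y_0)$, which is a fixed point of $f^{\mathcal{S}}$. It is unique if and only if $\det(I-M_{\mathcal{S}})\ne0$;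 then its points are denoted $(x_i^{\mathcal{S}},y_i^{\mathcal{S}})$. It is admissible if $x_i\le0$ whenever $\mathcal{S}_i=L$ and $x_i\ge0$ whenever $\mathcal{S}_i=R$; in that case it is a periodic solution of $f$. Stable means (Lyapunov) stable as a periodic solution of $f$ (not necessarily asymptotically stable). $(u,v)$-coordinates. Let $\zeta_1,\zeta_2$ be eigenvectors of $M_{\mathcal{X}}$ for $\lambda_1,\lambda_2$, let $Q=[\zeta_1\;\zeta_2]$, and set $$\begin{bmatrix} u \\ v \end{bmatrix}=Q^{-1}\left(\begin{bmatrix} x \\ y \end{bmatrix}-\begin{bmatrix} x_0^{\mathcal{X}} \\ y_0^{\mathcal{X}} \end{bmatrix}\right).$$ The $u$-axis is the line $v=0$ and the $v$-axis is the line $u=0$. For any word $\mathcal{S}$, $g^{\mathcal{S}}$ denotes $f^{\mathcal{S}}$ written in $(u,v)$-coordinates. ''Maps the $v$-axis to the $u$-axis'' means the image of the $v$-axis is contained in the $u$-axis. Homoclinic orbits and limits. An orbit $\{z_i\}_{i\in\mathbb{Z}}$ of $f$ (so $z_{i+1}=f(z_i)$ for all $i\in\mathbb{Z}$) is homoclinic to the $\mathcal{X}$-cycle if it is not contained in the $\mathcal{X}$-cycle and the distance from $z_i$ to the $\mathcal{X}$-cycle tends to $0$ as $i\to\infty$ and as $i\to-\infty$. The $\mathcal{S}[k]$-cycles limit to $\{z_i\}$ as $k\to\infty$ if, for each fixed $i\in\mathbb{Z}$, the point of the $\mathcal{S}[k]$-cycle with index $kn_{\mathcal{X}}+i$ (taken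 modulo $kn_{\mathcal{X}}+n_{\mathcal{Y}}$) converges to $z_i$ as $k\to\infty$ (through values of $k$ for which the $\mathcal{S}[k]$-cycle is unique). *)

(* Defs.v *)
From HB Require Import structures.
From mathcomp Require Import all_boot all_order all_algebra.
From mathcomp Require Import all_classical all_reals all_analysis.

Set Implicit Arguments.
Unset Strict Implicit.
Unset Printing Implicit Defensive.

Import Order.TTheory GRing.Theory Num.Theory.
Import numFieldNormedType.Exports.

Local Open Scope classical_set_scope.
Local Open Scope ring_scope.

Inductive symbol := symL | symR.

Definition word := seq symbol.

Definition wpow (k : nat) (W : word) : word := flatten (nseq k W).

Definition primitive (W : word) : Prop :=
  forall (V : word) (m : nat),
    (size V < size W)%N -> (2 <= m)%N -> W <> wpow m V.

(* The periodic symbol sequence Z -> {L, R} identified with a nonempty word.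
   The default value of nth is never used, as (i %% n)%Z lies in [0, n). *)
Definition symbol_at (W : word) (i : int) : symbol :=
  nth symL W `|(i %% (size W)%:Z)%Z|%N.

Section BorderCollision.
Variable R : realType.

Notation pt := 'cV[R]_2.

Definition xcoord (z : pt) : R := z ord0 ord0.
Definition ycoord (z : pt) : R := z ord_max ord0.

Definition mkpoint (x y : R) : pt :=
  \col_(i < 2) (if i == ord0 then x else y).

Record bcnf := BCNF { tauL : R; deltaL : R; tauR : R; deltaR : R; mu : R }.

Variable p : bcnf.

Definition Amx (J : symbol) : 'M[R]_2 :=
  let: (tau, delta) :=
    match J with symL => (tauL p, deltaL p) | symR => (tauR p, deltaR p) end in
  row_mx (mkpoint tau (- delta)) (mkpoint 1 0) : 'M[R]_(2, 1 + 1).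

Definition fhalf (J : symbol) (z : pt) : pt :=
  Amx J *m z + mu p *: mkpoint 1 0.

(* fhalf symL and fhalf symR agree on the line x = 0. *)
Definition bcmap (z : pt) : pt :=
  if xcoord z <= 0 then fhalf symL z else fhalf symR z.

Definition switching_manifold : set pt := [set z | xcoord z = 0].

(* The leftmost symbol is applied first. *)
Definition fword (S : word) (z : pt) : pt :=
  foldl (fun w J => fhalf J w) z S.

Definition Mword (S : word) : 'M[R]_2 :=
  foldl (fun B J => Amx J *m B) 1%:M S.

(* A tuple of points with indices modulo size S is encoded as a
   (size S)-periodic family indexed by int. *)
Definition is_cycle (S : word) (z : int -> pt) : Prop :=
  (forall i, z (i + (size S)%:Z) = z i) /\
  (forall i, z (i + 1) = fhalf (symbol_at S i) (z i)).

Definition has_unique_cycle (S : word) : Prop := exists! z, is_cycle S z.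

(* Meaningful when has_unique_cycle S holds: the points (x_i^S, y_i^S). *)
Definition cycle_of (S : word) : int -> pt := get [set z | is_cycle S z].

Definition admissible (S : word) (z : int -> pt) : Prop :=
  forall i : int, match symbol_at S i with
                  | symL => xcoord (z i) <= 0
                  | symR => 0 <= xcoord (z i)
                  end.

(* Lyapunov stability under iteration of bcmap (not of the affine map fword). *)
(* The matrix norm is the max norm; as norms on R^2 are equivalent, this choice
   affects neither stability nor the convergence statements below. *)
Definition lyapunov_stable (z : int -> pt) : Prop :=
  forall (i : int) (eps : R), 0 < eps ->
    exists2 eta : R, 0 < eta &
      forall w : pt, `|w - z i| < eta ->
        forall t : nat, `|iter t bcmap w - z (i + t%:Z)| < eps.

Definition is_orbit (z : int -> pt) : Prop :=
  forall i : int, z (i + 1) = bcmap (z i).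

Definition set_dist (z : pt) (A : set pt) : R :=
  inf [set `|z - a| | a in A].

Definition homoclinic (z c : int -> pt) : Prop :=
  [/\ is_orbit z,
      ~ (range z `<=` range c),
      (fun n : nat => set_dist (z n%:Z) (range c)) @ \oo --> (0 : R) &
      (fun n : nat => set_dist (z (- n%:Z)) (range c)) @ \oo --> (0 : R)].

(* Right eigenvectors; the library's eigenvectors are row vectors. *)
Definition is_eigenvector (B : 'M[R]_2) (lambda : R) (zeta : pt) : Prop :=
  zeta != 0 /\ B *m zeta = lambda *: zeta.

Definition Qmx (zeta1 zeta2 : pt) : 'M[R]_2 :=
  row_mx zeta1 zeta2 : 'M[R]_(2, 1 + 1).

Definition to_uv (Q : 'M[R]_2) (z0 z : pt) : pt := invmx Q *m (z - z0).
Definition of_uv (Q : 'M[R]_2) (z0 w : pt) : pt := Q *m w + z0.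

(* Points of the (u, v)-plane: xcoord is u and ycoord is v. *)
Definition u_axis : set pt := [set w | ycoord w = 0].
Definition v_axis : set pt := [set w | xcoord w = 0].

Definition gword (Q : 'M[R]_2) (z0 : pt) (S : word) (w : pt) : pt :=
  to_uv Q z0 (fword S (of_uv Q z0 w)).

(* For two lines; coincident lines count as parallel. *)
Definition parallel (A B : set pt) : Prop :=
  exists d : pt, B = [set a + d | a in A].

Definition XkY (X Y : word) (k : nat) : word := wpow k X ++ Y.

Definition cycles_limit_to (X Y : word) (z : int -> pt) : Prop :=
  forall i : int,
    cycle_of (XkY X Y k) ((k * size X)%N%:Z + i)
      @[k --> within [set k | has_unique_cycle (XkY X Y k)] \oo] --> z i.

End BorderCollision.

(* Main.v *)
Require Import Defs.
From HB Require Import structures.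
From mathcomp Require Import all_boot all_order all_algebra.
From mathcomp Require Import all_classical all_reals all_analysis.
From mathcomp Require Import zify ring lra.

Set Implicit Arguments.
Unset Strict Implicit.
Unset Printing Implicit Defensive.

Import Order.TTheory GRing.Theory Num.Theory.
Import numFieldNormedType.Exports.

Local Open Scope classical_set_scope.
Local Open Scope ring_scope.

(** In the eigenvector coordinates centred at the X-cycle, g^X is the diagonal
    map (u, v) |-> (l1 u, l2 v) and
      g^Y (u, v) = (a u + b v + s1, c u + d v + s2),
    so the first point (u_k, v_k) of the cycle of X^k Y solves
      u = a l1^k u + b l2^k v + s1,    v = c l1^k u + d l2^k v + s2.
    Two facts about each of the infinitely many good cycles decide everything.

    Stability.  A cycle that avoids the switching manifold is surrounded by
    points that follow the same symbols forever, so Lyapunov stability says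
    that the powers of M = M_Y M_X^k are bounded ([stable_power_bounded]).
    For a real 2 x 2 matrix this forces |det M| <= 1 and
    (tr M)^2 <= 2 + 2 det M ([power_bounded_det], [power_bounded_trace_det]),
    where tr M = a l1^k + d l2^k and det M = (a d - b c) (l1 l2)^k.  Since
    l2 > 1, boundedness of the trace already gives d = 0 ([d_eq0]).

    Opposite sides.  Since X and Y start with different symbols, the images of
    the first point of the cycle under f^{X^{k-1}} and f^{X^k} lie strictly on
    different sides of the switching manifold.  Rescaled by a common factor,
    their first coordinates converge as k grows, and the product of the two
    limits cannot be positive ([opposite_sign_limits]).  If s2 <> 0, the term
    in v dominates both, by the factor l2 at the second, because the v-axis
    is transverse to the switching manifold: a contradiction ([s2_eq0]).
    With d = s2 = 0, the v-axis is mapped to the u-axis, and s1 <> 0, as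
    otherwise the base point of the X-cycle would be the unique fixed point
    of g^{X^k Y}, and the two points above would coincide.  If l1 l2 <> 1,
    then either both points converge to the base point of the X-cycle, or
    one common term dominates both ([rho_eq1]).

    Finally l1 l2 = 1 makes u_k (1 - a l1^k - b c) = s1 and l2^k v_k = c u_k.
    Here b c <> 1, for otherwise det M = -1, so tr M = 0, so s1 = 0
    ([bc_neq1]).  Hence u_k converges to u := s1 / (1 - b c) <> 0, and the
    cycle, read from index k n_X, converges to the orbit that leaves the
    X-cycle along the v-axis through (0, c u), is sent by g^Y to (u, 0), and
    returns along the u-axis ([cvg_limit_orbit]).  It is an orbit of f because
    f is continuous, and it is not contained in the X-cycle because (u, 0) is
    not periodic under g^X. *)

(** * Words and cycles *)

Lemma wpowS k W : wpow k.+1 W = W ++ wpow k W.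
Proof. by []. Qed.

Lemma wpowD j k W : wpow (j + k) W = wpow j W ++ wpow k W.
Proof. by rewrite /wpow nseqD flatten_cat. Qed.

Lemma size_wpow k W : size (wpow k W) = (k * size W)%N.
Proof. by elim: k => // k IH; rewrite wpowS size_cat IH mulSn. Qed.

Lemma size_XkY X Y k : size (XkY X Y k) = (k * size X + size Y)%N.
Proof. by rewrite size_cat size_wpow. Qed.

Lemma take_XkY_block X Y k j r : (j < k)%N -> (r <= size X)%N ->
  take (j * size X + r) (XkY X Y k) = wpow j X ++ take r X.
Proof.
move=> jk rX; rewrite /XkY -(subnKC jk) addSnnS wpowD wpowS -!catA.
rewrite take_cat size_wpow ltnNge leq_addr /= addKn take_cat.
case: ltngtP rX => // -> _; by rewrite subnn take0 cats0 take_size.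
Qed.

Lemma take_XkY_tail X Y k i :
  take (k * size X + i) (XkY X Y k) = wpow k X ++ take i Y.
Proof. by rewrite take_cat size_wpow ltnNge leq_addr /= addKn. Qed.

Lemma symbol_at_nat W n : (n < size W)%N -> symbol_at W n%:Z = nth symL W n.
Proof. by move=> nW; rewrite /symbol_at modz_nat absz_nat modn_small. Qed.

Lemma symbol_at_XkY_block X Y k j r : (j < k)%N -> (r < size X)%N ->
  symbol_at (XkY X Y k) (j * size X + r)%N%:Z = symbol_at X r%:Z.
Proof.
move=> jk rX; have lt_S : (j * size X + r < size (XkY X Y k))%N.
  rewrite size_XkY ltn_addr // -ltn_subRL -mulnBl (leq_trans rX) //.
  rewrite leq_pmull //.
  by rewrite subn_gt0.
rewrite !symbol_at_nat // -(nth_take symL (ltnSn _)) -addnS take_XkY_block //.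
by rewrite nth_cat size_wpow ltnNge leq_addr /= addKn nth_take.
Qed.

Lemma symbol_at_XkY_tail X Y k : (0 < size Y)%N ->
  symbol_at (XkY X Y k) (k * size X)%N%:Z = symbol_at Y 0.
Proof.
move=> Y0; rewrite !symbol_at_nat // ?size_XkY; last by lia.
by rewrite /XkY nth_cat size_wpow ltnn subnn.
Qed.

Section Dynamics.
Variables (R : realType) (p : bcnf R).
Notation pt := 'cV[R]_2.

Lemma fword_cat S T (z : pt) : fword p (S ++ T) z = fword p T (fword p S z).
Proof. exact: foldl_cat. Qed.

Lemma Mword_cat S T : Mword p (S ++ T) = Mword p T *m Mword p S.
Proof.
rewrite /Mword foldl_cat; move: (foldl _ 1%:M S) => B.
elim/last_ind: T => [|T J IH]; first by rewrite mul1mx.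
by rewrite !foldl_rcons IH mulmxA.
Qed.

Lemma fword_rcons S J (z : pt) :
  fword p (rcons S J) z = fhalf p J (fword p S z).
Proof. exact: foldl_rcons. Qed.

Lemma Mword_rcons S J : Mword p (rcons S J) = Amx p J *m Mword p S.
Proof. exact: foldl_rcons. Qed.

Lemma fhalf_sub J (z w : pt) : fhalf p J z - fhalf p J w = Amx p J *m (z - w).
Proof. by rewrite /fhalf mulmxBr opprD addrACA subrr addr0. Qed.

Lemma fword_sub S (z w : pt) : fword p S z - fword p S w = Mword p S *m (z - w).
Proof.
elim/last_ind: S => [|S J IH]; first by rewrite mul1mx.
by rewrite !fword_rcons Mword_rcons fhalf_sub IH mulmxA.
Qed.

Lemma fwordD S (z h : pt) : fword p S (z + h) = fword p S z + Mword p S *m h.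
Proof. by rewrite -[h in RHS](addrK z) -fword_sub [RHS]addrC subrK addrC. Qed.

Lemma Mword_wpow k S : Mword p (wpow k S) = Mword p S ^+ k.
Proof. by elim: k => // k IH; rewrite wpowS Mword_cat IH exprSr. Qed.

Lemma cycle_periodic S (z : int -> pt) : is_cycle p S z ->
  forall i (k : int), z (i + k * (size S)%:Z) = z i.
Proof.
case=> zS _; have zSn i n : z (i + (n * size S)%N%:Z) = z i.
  by elim: n => [|n IH]; rewrite ?mul0n ?addr0 // mulSn addnC PoszD addrA zS.
move=> i [n|n]; first by rewrite -PoszM zSn.
by rewrite NegzE mulNr -PoszM -(zSn _ n.+1) subrK.
Qed.

Lemma cycle_prefix S (z : int -> pt) : is_cycle p S z ->
  forall m, (m <= size S)%N -> z m%:Z = fword p (take m S) (z 0).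
Proof.
case=> _ zS; elim=> [|m IH] mS; first by rewrite take0.
rewrite (take_nth symL) // fword_rcons -IH 1?ltnW // -symbol_at_nat // -zS.
by rewrite -PoszD addn1.
Qed.

Lemma cycle_fixed S (z : int -> pt) : is_cycle p S z -> fword p S (z 0) = z 0.
Proof.
move=> zS; have := cycle_prefix zS (leqnn _); rewrite take_size => <-.
by case: zS => zS _; rewrite -[RHS]zS add0r.
Qed.

Lemma cycle_from_fixed S (w : pt) : (0 < size S)%N -> fword p S w = w ->
  exists2 z, is_cycle p S z & z 0 = w.
Proof.
move=> S0 wS.
exists (fun i => fword p (take `|(i %% (size S)%:Z)%Z|%N S) w); last first.
  by rewrite mod0z take0.
split=> i /=; first by rewrite modzDr.
have Sz : (size S)%:Z != 0 by rewrite -lt0n.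
rewrite /symbol_at -modzDml; have := ltz_mod i Sz; have := modz_ge0 i Sz.
case: (i %% _)%Z => // m _; rewrite ltz_nat absz_nat => mS.
rewrite -fword_rcons -take_nth // -PoszD addn1 modz_nat absz_nat.
(* At the last symbol the index wraps around to 0. *)
move: mS; rewrite leq_eqVlt => /predU1P[->|mS]; last by rewrite modn_small.
by rewrite modnn take0 take_size wS.
Qed.

Lemma is_cycle_of S : (exists z, is_cycle p S z) -> is_cycle p S (cycle_of p S).
Proof. exact: getPex. Qed.

Lemma unique_is_cycle S : has_unique_cycle p S -> is_cycle p S (cycle_of p S).
Proof. by case=> z [zS _]; apply: is_cycle_of; exists z. Qed.

Lemma unique_cycle_eq S (z : int -> pt) :
  has_unique_cycle p S -> is_cycle p S z -> cycle_of p S = z.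
Proof.
move=> U zS; have := unique_is_cycle U.
by case: U => c [_ Uc] /Uc <-; apply: Uc.
Qed.

End Dynamics.
(** * Power-bounded two-by-two matrices *)

Section TwoByTwo.
Variable R : realType.
Implicit Types M N : 'M[R]_2.

Lemma sum2 (V : nmodType) (F : 'I_2 -> V) : \sum_i F i = F ord0 + F ord_max.
Proof. by rewrite big_ord_recl big_ord1; congr (_ + F _); apply: val_inj. Qed.

Lemma ord2P (P : 'I_2 -> Prop) : P ord0 -> P ord_max -> forall i, P i.
Proof.
move=> P0 P1 [[|[|//]] i2].
- by rewrite (_ : Ordinal i2 = ord0) //; apply: val_inj.
- by rewrite (_ : Ordinal i2 = ord_max) //; apply: val_inj.
Qed.

Lemma det2 M :
  \det M = M ord0 ord0 * M ord_max ord_max - M ord0 ord_max * M ord_max ord0.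
Proof.
rewrite (expand_det_row _ ord0) sum2 /cofactor !det_mx11 !mxE /=.
rewrite (_ : lift ord0 0 = ord_max); last exact: val_inj.
rewrite (_ : lift ord_max 0 = ord0); last exact: val_inj.
by ring.
Qed.

Lemma mxtrace2 M : \tr M = M ord0 ord0 + M ord_max ord_max.
Proof. exact: sum2. Qed.

Lemma mxtrace_sqr M : \tr (M ^+ 2) = \tr M ^+ 2 - 2 * \det M.
Proof. by rewrite det2 !mxtrace2 expr2 !mxE !sum2; ring. Qed.

Lemma le1_expr_bounded (r C : R) : (forall n, r ^+ n <= C) -> r <= 1.
Proof.
move=> rC; rewrite leNgt; apply/negP => r1.
have bern n : 1 + n%:R * (r - 1) <= r ^+ n.
  elim: n => [|n IH]; first by rewrite mul0r addr0.
  have n0 : 0 <= n%:R * (r - 1) ^+ 2 by rewrite mulr_ge0 ?sqr_ge0.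
  rewrite exprS; apply: le_trans (_ : r * (1 + n%:R * (r - 1)) <= _).
    by rewrite -natr1; move: n0; set m := n%:R; rewrite expr2; lra.
  by rewrite ler_pM2l //; lra.
have C1 : 1 <= C by have := rC 0; rewrite expr0.
have := archi_boundP (_ : 0 <= C / (r - 1)).
set n := Num.bound _ => /(_ _)/wrap[]; first by rewrite divr_ge0 //; lra.
rewrite ltr_pdivrMr ?subr_gt0 // => Cn.
by have := bern n; have := rC n; lra.
Qed.

Lemma detX M n : \det (M ^+ n) = \det M ^+ n.
Proof.
by elim: n => [|n IH]; rewrite ?expr0 ?det1 // !exprS det_mulmx IH.
Qed.

Definition power_bounded M : Prop :=
  exists C, forall n i j, `|(M ^+ n) i j| <= C.

Lemma power_bounded_expr M n : power_bounded M -> power_bounded (M ^+ n).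
Proof. by case=> C MC; exists C => m i j; rewrite -exprM. Qed.

Lemma power_bounded_det M : power_bounded M -> `|\det M| <= 1.
Proof.
case=> C MC; apply: (@le1_expr_bounded _ (C * C + C * C)) => n.
have C0 : 0 <= C by apply: le_trans (MC 0 ord0 ord0); apply: normr_ge0.
rewrite -normrX -detX // det2; apply: le_trans (ler_normB _ _) _.
by rewrite !normrM; apply: lerD; apply: ler_pM => //; apply: MC.
Qed.

(** Repeated squaring: by [mxtrace_sqr] the traces of the 2^n-th powers satisfy
    s' = s^2 - 2 det with det <= 1, a recursion under which a starting value
    above 2 grows geometrically. *)
Lemma power_bounded_trace_le2 M : power_bounded M -> \tr M <= 2.
Proof.
move=> Mb; have det1 := power_bounded_det Mb.
case: Mb => C MC; rewrite leNgt; apply/negP => tr2.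
(* With s the trace of the 2^n-th power, the next trace minus 2 is at least
   s^2 - 4 = (s + 2)(s - 2), hence at least 4 (s - 2). *)
have trM n : \tr M - 2 <= \tr (M ^+ (2 ^ n)) - 2 /\
    4 ^+ n * (\tr M - 2) <= \tr (M ^+ (2 ^ n)) - 2.
  elim: n => [|n [IH1 IH2]]; first by rewrite expn0 expr1 expr0 mul1r.
  rewrite expnSr exprM mxtrace_sqr [4 ^+ _]exprS.
  have : \det (M ^+ (2 ^ n)) <= 1.
    rewrite detX; apply: le_trans (ler_norm _) _.
    by rewrite normrX exprn_ile1.
  move: IH1 IH2; set s := \tr (M ^+ _) => IH1 IH2 detn.
  have : 4 * (s - 2) <= s ^+ 2 - 4 by nra.
  by rewrite -mulrA; split; lra.
suff : (4 : R) <= 1 by lra.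
apply: (@le1_expr_bounded _ ((C + C) / (\tr M - 2))) => n.
rewrite ler_pdivlMr ?subr_gt0 //; apply: le_trans (trM n).2 _.
rewrite mxtrace2; apply: le_trans (_ : (M ^+ (2 ^ n)) ord0 ord0 +
  (M ^+ (2 ^ n)) ord_max ord_max <= _).
  by lra.
by apply: lerD; apply: le_trans (ler_norm _) (MC _ _ _).
Qed.

(** The trace bound applied to M^2.  It excludes at once eigenvalues of modulus
    greater than 1 and, when det M = -1, any trace other than 0. *)
Lemma power_bounded_trace_det M :
  power_bounded M -> \tr M ^+ 2 <= 2 + 2 * \det M.
Proof.
move=> /(power_bounded_expr 2)/power_bounded_trace_le2.
by rewrite mxtrace_sqr lerBlDr.
Qed.

Lemma row_mx2E (a b : 'cV[R]_2) i : let A : 'M[R]_(2, 1 + 1) := row_mx a b in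
  A i (ord0 : 'I_2) = a i ord0 /\ A i (ord_max : 'I_2) = b i ord0.
Proof.
split.
- have -> : (ord0 : 'I_2) = lshift 1 (ord0 : 'I_1) by apply: val_inj.
  exact: row_mxEl.
- have -> : (ord_max : 'I_2) = rshift 1 (ord0 : 'I_1) by apply: val_inj.
  exact: row_mxEr.
Qed.

Lemma mul_row_mx2 (a b z : 'cV[R]_2) :
  (row_mx a b : 'M[R]_(2, 1 + 1)) *m z = xcoord z *: a + ycoord z *: b.
Proof.
apply/matrixP => i j; rewrite ord1 !mxE sum2.
rewrite (row_mx2E a b i).1 (row_mx2E a b i).2.
by rewrite /xcoord /ycoord !(mulrC (z _ _)).
Qed.

Lemma le_coord (z : 'cV[R]_2) i : `|z i ord0| <= `|z|.
Proof.
have := @le_bigmax _ R _ 0 (fun ij : 'I_2 * 'I_1 => `|z ij.1 ij.2|) (i, ord0).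
by rewrite -mx_normrE.
Qed.

(** Uniform boundedness of the iterates on a ball bounds the entries of the
    powers, as these are coordinates of images of scaled unit vectors. *)
Lemma power_bounded_ball M (eta C : R) : 0 < eta ->
  (forall h : 'cV[R]_2, `|h| < eta -> forall n, `|M ^+ n *m h| <= C) ->
  power_bounded M.
Proof.
move=> eta0 MC; pose r := eta / 2; have r0 : 0 < r by rewrite divr_gt0.
exists (C / r) => n i j; rewrite ler_pdivlMr //.
have := MC (r *: delta_mx j ord0) _ n.
have -> : `|r *: delta_mx j (ord0 : 'I_1) : 'cV[R]_2| = r.
  apply/eqP; rewrite normrZ gtr0_norm // eq_le; apply/andP; split.
    rewrite -[leRHS]mulr1 ler_pM2l //.
    change (mx_norm (delta_mx j ord0 : 'cV[R]_2) <= 1).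
    rewrite mx_normrE; apply: bigmax_le => //.
    move=> [a b] _ /=; rewrite mxE.
    by case: (_ && _); rewrite ?normr1 ?normr0.
  apply: le_trans (_ : r * `|(delta_mx j ord0 : 'cV[R]_2) j ord0| <= _).
    by rewrite mxE !eqxx normr1 mulr1.
  by rewrite ler_pM2l // le_coord.
move=> /(_ _)/wrap[]; first by rewrite /r; lra.
move=> /(le_trans (le_coord _ i)); apply: le_trans.
rewrite -scalemxAr mxE -colE mxE normrM (gtr0_norm r0) mulrC.
by [].
Qed.

End TwoByTwo.

(** * Stability of cycles off the switching manifold *)

Section Stability.
Variables (R : realType) (p : bcnf R).
Notation pt := 'cV[R]_2.
Implicit Types (S : word) (z : int -> pt).

Lemma fhalfE J (z : pt) : fhalf p J z =
  xcoord z *: (Amx p J *m mkpoint 1 0) + ycoord z *: mkpoint 1 0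
  + mu p *: mkpoint 1 0.
Proof.
by rewrite /fhalf /Amx; case: J; rewrite !mul_row_mx2 /xcoord /ycoord !mxE /=
  scale1r scale0r addr0.
Qed.

Lemma fhalf_switching (z : pt) :
  xcoord z = 0 -> fhalf p symL z = fhalf p symR z.
Proof. by move=> x0; rewrite !fhalfE x0 !scale0r. Qed.

(** On the switching manifold both symbols are allowed, because the two halves
    agree there. *)
Lemma bcmap_fhalf J (z : pt) :
  match J with symL => xcoord z <= 0 | symR => 0 <= xcoord z end ->
  bcmap p z = fhalf p J z.
Proof.
rewrite /bcmap; case: J; case: ifP => // z0 z0'.
by apply: fhalf_switching; apply/eqP; rewrite eq_le z0 z0'.
Qed.

Lemma cycle_mod S z : is_cycle p S z ->
  forall n : nat, z n%:Z = z (n %% size S)%N%:Z.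
Proof.
move=> zS n; rewrite {1}(divn_eq n (size S)) addnC PoszD PoszM.
exact: (cycle_periodic zS).
Qed.

Lemma cycle_gap S z : (0 < size S)%N -> is_cycle p S z ->
  (forall i, ~ switching_manifold (z i)) ->
  exists2 eps, 0 < eps & forall n : nat, eps <= `|xcoord (z n%:Z)|.
Proof.
move=> S0 zS nsw.
have [eps eps0 epsP] : exists2 eps, 0 < eps &
    forall n : nat, (n < size S)%N -> eps <= `|xcoord (z n%:Z)|.
  elim: (size S) => [|m [eps eps0 IH]]; first by exists 1.
  have xm0 : 0 < `|xcoord (z m%:Z)|.
    by rewrite normr_gt0; apply/eqP; apply: nsw.
  exists (Num.min eps `|xcoord (z m%:Z)|); first by rewrite lt_min eps0.
  move=> n; rewrite ltnS leq_eqVlt => /predU1P[->|/IH epsn].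
    by rewrite ge_min lexx orbT.
  by rewrite ge_min epsn.
by exists eps => // n; rewrite (cycle_mod zS) epsP // ltn_mod.
Qed.

(** A perturbation smaller than the distance to the switching manifold does not
    change the side on which a point lies. *)
Lemma admissible_shadow S z (n : nat) (w : pt) : admissible S z ->
  `|w - z n%:Z| < `|xcoord (z n%:Z)| ->
  bcmap p w = fhalf p (symbol_at S n%:Z) w.
Proof.
move=> adm near_w; apply: bcmap_fhalf.
have : `|xcoord w - xcoord (z n%:Z)| < `|xcoord (z n%:Z)|.
  apply: le_lt_trans near_w; have := le_coord (w - z n%:Z) ord0.
  by rewrite /xcoord !mxE.
rewrite ltr_norml => /andP[].
have := adm n%:Z; case: (symbol_at S n%:Z) => xz.
  by rewrite ler0_norm // => _; lra.
by rewrite ger0_norm //; lra.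
Qed.

(** Stability is applied with epsilon equal to the distance of the cycle from
    the switching manifold: perturbed orbits then follow the symbols of the
    cycle forever, so their deviation after n periods is exactly M_S^n h. *)
Lemma stable_power_bounded S z : (0 < size S)%N ->
  is_cycle p S z -> admissible S z -> lyapunov_stable p z ->
  (forall i, ~ switching_manifold (z i)) -> power_bounded (Mword p S).
Proof.
move=> S0 zS adm stab /(cycle_gap S0 zS)[eps eps0 gap].
have [eta eta0 etaP] := stab 0 eps eps0.
apply: (@power_bounded_ball _ _ eta eps eta0) => h h_eta n.
set w := z 0 + h.
have w_near t : `|iter t (bcmap p) w - z t%:Z| < eps.
  by rewrite -[t%:Z]add0r; apply: etaP; rewrite /w addrAC subrr add0r.
have step t : iter t.+1 (bcmap p) w - z t.+1%:Z =
    Amx p (symbol_at S t%:Z) *m (iter t (bcmap p) w - z t%:Z).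
  have shadow := admissible_shadow adm (lt_le_trans (w_near t) (gap t)).
  by rewrite -fhalf_sub -(proj2 zS) -shadow -PoszD addn1.
suff -> : Mword p S ^+ n *m h =
    iter (n * size S) (bcmap p) w - z (n * size S)%N%:Z.
  exact: ltW.
have prefix t m : (m <= size S)%N ->
    iter (t * size S + m) (bcmap p) w - z (t * size S + m)%N%:Z =
    Mword p (take m S) *m (iter (t * size S) (bcmap p) w - z (t * size S)%N%:Z).
  elim: m => [|m IH] mS; first by rewrite take0 mul1mx addn0.
  rewrite addnS step IH 1?ltnW // mulmxA (take_nth symL) // Mword_rcons.
  congr (Amx p _ *m _ *m _); rewrite -symbol_at_nat // /symbol_at.
  by rewrite !modz_nat modnMDl.
elim: n => [|n IH]; first by rewrite expr0 mul1mx mul0n /w addrAC subrr add0r.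
rewrite exprS -mulmxA IH mulSnr prefix // take_size //.
Qed.

End Stability.

(** * Limits of real sequences along a filter of indices *)

Section Asymptotics.
Variables (R : realType) (F : set_system nat).
Context {FF : ProperFilter F}.
Hypothesis Foo : F --> \oo.

Lemma cvg_along (T : topologicalType) (f : nat -> T) (l : T) :
  f n @[n --> \oo] --> l -> f n @[n --> F] --> l.
Proof. by apply: cvg_trans; apply: cvg_app. Qed.

Lemma cvg_expr_along (r : R) : 0 <= r -> r < 1 -> r ^+ k @[k --> F] --> 0.
Proof.
by move=> r0 r1; apply: (@cvg_along R^o); apply: cvg_expr; rewrite ger0_norm.
Qed.

Lemma cvg_expr_pred_along (r : R) :
  0 <= r -> r < 1 -> r ^+ k.-1 @[k --> F] --> 0.
Proof.
move=> r0 r1; apply: (@cvg_along R^o).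
rewrite -(@cvg_shiftS R^o (fun k => r ^+ k.-1)) /=.
by apply: cvg_expr; rewrite ger0_norm.
Qed.

Lemma cvg_limit_eq (f : nat -> R) (l l' : R) :
  l = l' -> f k @[k --> F] --> l -> f k @[k --> F] --> l'.
Proof. by move=> ->. Qed.

(** The multiplier w is unrestricted, even in sign, because it enters the product
    only through its square. *)
Lemma opposite_sign_limits (w x y : nat -> R) (A B : R) :
  (\forall k \near F, x k * y k < 0) ->
  w k * x k @[k --> F] --> A -> w k * y k @[k --> F] --> B -> A * B <= 0.
Proof.
move=> xy wA wB; apply: (cvgr_to_le (cvgM wA wB)).
apply: filterS xy => k xy /=.
by rewrite mulrACA mulr_ge0_le0 -?expr2 ?sqr_ge0 ?ltW.
Qed.

Lemma cvg_quotient (u E : nat -> R) (s e : R) : e != 0 ->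
  (\forall k \near F, u k * E k = s) -> E k @[k --> F] --> e ->
  u k @[k --> F] --> s / e.
Proof.
move=> e0 uE Ee; apply: cvg_trans (cvgM (cvg_cst s) (cvgV e0 Ee)).
apply: near_eq_cvg; near=> k => /=.
have Ek : E k != 0 by near: k; apply: cvgr_neq0 Ee e0.
have <- : u k * E k = s by near: k.
by rewrite mulfK.
Unshelve. all: by end_near.
Qed.

End Asymptotics.

(** Decomposes a polynomial expression in sequences.  The case analysis is on the
    sequence rather than on the limit, since the limit of an atomic sequence may
    itself be a sum or a product.  A sequence that is a local variable is looked
    up before the constant case, whose pattern would match its eta-expansion. *)
Ltac solve_cvg := lazymatch goal with
  | |- cvg_to (nbhs (fmap ?f _)) _ =>
    tryif is_var f then assumption else solve_cvg_compound
  end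
with solve_cvg_compound := lazymatch goal with
  | |- cvg_to (nbhs (fmap (fun=> ?c) _)) _ => exact: cvg_cst
  | |- cvg_to (nbhs (fmap (fun=> @Algebra.add _ _ _) _)) _ =>
    apply: cvgD; solve_cvg
  | |- cvg_to (nbhs (fmap (fun=> @GRing.mul _ _ _) _)) _ =>
    apply: cvgM; solve_cvg
  | |- cvg_to (nbhs (fmap (fun=> @Algebra.opp _ _) _)) _ =>
    apply: cvgN; solve_cvg
  | |- _ => assumption
  end.

(** * Fixed points of the return maps for large k *)

Section ReturnMaps.
Variables (R : realType) (F : set_system nat).
Context {FF : ProperFilter F}.
Hypothesis Foo : F --> \oo.
Variables (l1 l2 a b c d s1 s2 x0 q1 q2 : R) (u v : nat -> R).
Hypotheses (l1_ge0 : 0 <= l1) (l1_lt1 : l1 < 1) (l2_gt1 : 1 < l2).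
Hypothesis q2_neq0 : q2 != 0.

(* First coordinates of the points from which Y and the last copy of X start. *)
Let xY k := x0 + q1 * (l1 ^+ k * u k) + q2 * (l2 ^+ k * v k).
Let xX k := x0 + q1 * (l1 ^+ k.-1 * u k) + q2 * (l2 ^+ k.-1 * v k).

Hypothesis k_gt0 : \forall k \near F, (0 < k)%N.
Hypothesis fix_u :
  \forall k \near F, u k = a * (l1 ^+ k * u k) + b * (l2 ^+ k * v k) + s1.
Hypothesis fix_v :
  \forall k \near F, v k = c * (l1 ^+ k * u k) + d * (l2 ^+ k * v k) + s2.
Hypothesis sides : \forall k \near F, xX k * xY k < 0.
(* Trace and determinant of the matrix part of the k-th return map. *)
Let tr k := a * l1 ^+ k + d * l2 ^+ k.
Let det k := (a * d - b * c) * (l1 * l2) ^+ k.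
Hypothesis det_le1 : \forall k \near F, `|det k| <= 1.
Hypothesis tr_det : \forall k \near F, tr k ^+ 2 <= 2 + 2 * det k.

Let l2_gt0 : 0 < l2. Proof. exact: lt_trans l2_gt1. Qed.
Let l2V_ge0 : 0 <= l2^-1. Proof. by rewrite invr_ge0 ltW. Qed.
Let l2V_lt1 : l2^-1 < 1. Proof. by rewrite invf_lt1. Qed.
Let l2_neq0 : l2 != 0. Proof. exact: lt0r_neq0. Qed.
Let rho_ge0 : 0 <= l1 * l2. Proof. by rewrite mulr_ge0 // ltW. Qed.

Let cvg_l1 := cvg_expr_along Foo l1_ge0 l1_lt1.
Let cvg_l1' := cvg_expr_pred_along Foo l1_ge0 l1_lt1.
Let cvg_l2V := cvg_expr_along Foo l2V_ge0 l2V_lt1.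

(** Divide the bounded trace a l1^k + d l2^k by l2^k. *)
Lemma d_eq0 : d = 0.
Proof.
have cvg_d : a * l1 ^+ k * l2^-1 ^+ k + d @[k --> F] --> d.
  by rewrite -[X in _ --> X]add0r -[X in _ --> X + _](mulr0 (a * 0)); solve_cvg.
have cvg_n : `|a * l1 ^+ k * l2^-1 ^+ k + d| - 2 * l2^-1 ^+ k @[k --> F]
    --> `|d| - 2 * 0.
  by apply: cvgB; [exact: cvg_norm | solve_cvg].
apply/eqP; rewrite -normr_le0 -[`|d|]subr0 -[X in _ - X](mulr0 2).
apply: (cvgr_to_le cvg_n).
near=> k; rewrite /= subr_le0.
have -> : a * l1 ^+ k * l2^-1 ^+ k + d = tr k * l2^-1 ^+ k.
  by rewrite /tr mulrDl exprVn mulfK // expf_neq0.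
rewrite normrM [X in _ * X]ger0_norm ?exprn_ge0 // ler_wpM2r ?exprn_ge0 //.
have : tr k ^+ 2 <= 2 + 2 * det k by near: k.
have : `|det k| <= 1 by near: k.
by rewrite ler_norml => /andP[_]; rewrite real_ler_norml ?num_real //; nra.
Unshelve. all: by end_near.
Qed.

(* The determinant of I - M for the k-th return map, once d = 0. *)
Let E k := 1 - a * l1 ^+ k - b * c * (l1 * l2) ^+ k.

(** Eliminate v from the two fixed-point equations. *)
Lemma u_eq : \forall k \near F, u k * E k = b * l2 ^+ k * s2 + s1.
Proof.
near=> k.
have Hu : u k = a * (l1 ^+ k * u k) + b * (l2 ^+ k * v k) + s1 by near: k.
have Hv : v k = c * (l1 ^+ k * u k) + d * (l2 ^+ k * v k) + s2 by near: k.
rewrite d_eq0 mul0r addr0 in Hv; rewrite Hv in Hu.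
by rewrite /E exprMn; lra.
Unshelve. all: by end_near.
Qed.

(** After multiplication by E_k / l2^k, the first coordinates of the two points
    tend to q2 s2 and q2 s2 / l2, which have the same sign. *)
Lemma s2_eq0 : s2 = 0.
Proof.
pose w k := E k * l2^-1 ^+ k.
(* Closed forms of w, w u and w l2^k v, free of u and v. *)
pose EV k := l2^-1 ^+ k - a * (l1 ^+ k * l2^-1 ^+ k) - b * c * l1 ^+ k.
pose uV k := b * s2 + s1 * l2^-1 ^+ k.
pose vV k := c * l1 ^+ k * s1 + s2 * (1 - a * l1 ^+ k).
have cvgEV : EV k @[k --> F] --> 0.
  have -> : 0 = 0 - a * (0 * 0) - b * c * 0 :> R by ring.
  by rewrite /EV; solve_cvg.
have cvguV : uV k @[k --> F] --> b * s2.
  have -> : b * s2 = b * s2 + s1 * 0 by ring.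
  by rewrite /uV; solve_cvg.
have cvgvV : vV k @[k --> F] --> s2.
  have -> : s2 = c * 0 * s1 + s2 * (1 - a * 0) by ring.
  by rewrite /vV; solve_cvg.
have wE : \forall k \near F, [/\ w k = EV k, w k * u k = uV k
    & w k * (l2 ^+ k * v k) = vV k].
  near=> k.
  have Hv : v k = c * (l1 ^+ k * u k) + d * (l2 ^+ k * v k) + s2 by near: k.
  rewrite d_eq0 mul0r addr0 in Hv.
  have Hu : u k * E k = b * l2 ^+ k * s2 + s1 by near: k; exact: u_eq.
  have l2k : l2 ^+ k * l2^-1 ^+ k = 1 by rewrite -exprMn divff // expr1n.
  split.
  - by rewrite /w /E /EV exprMn !mulrBl mul1r -!mulrA l2k; ring.
  - have -> : w k * u k = (u k * E k) * l2^-1 ^+ k by rewrite /w; ring.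
    by rewrite Hu /uV mulrDl -!mulrA (mulrC s2) mulrA mulrA -(mulrA b) l2k; ring.
  - have -> : w k * (l2 ^+ k * v k) = (l2 ^+ k * l2^-1 ^+ k) * (E k * v k).
      by rewrite /w; ring.
    rewrite l2k mul1r Hv mulrDr.
    have -> : E k * (c * (l1 ^+ k * u k)) = c * l1 ^+ k * (u k * E k) by ring.
    by rewrite Hu /vV /E exprMn; ring.
have wY : w k * xY k @[k --> F] --> q2 * s2.
  have -> : q2 * s2 = 0 * x0 + q1 * (0 * (b * s2)) + q2 * s2 by ring.
  apply: cvg_trans (_ : EV k * x0 + q1 * (l1 ^+ k * uV k) + q2 * vV k
    @[k --> F] --> _); last by solve_cvg.
  apply: near_eq_cvg; near=> k.
  have [<- <- <-] : [/\ w k = EV k, w k * u k = uV k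
    & w k * (l2 ^+ k * v k) = vV k].
    by near: k.
  by rewrite /xY; ring.
have wX : w k * xX k @[k --> F] --> q2 * s2 / l2.
  have -> : q2 * s2 / l2 =
    0 * x0 + q1 * (0 * (b * s2)) + q2 * (s2 / l2) by ring.
  apply: cvg_trans (_ : EV k * x0 + q1 * (l1 ^+ k.-1 * uV k) + q2 * (vV k / l2)
    @[k --> F] --> _); last by solve_cvg.
  apply: near_eq_cvg; near=> k.
  have [<- <- <-] : [/\ w k = EV k, w k * u k = uV k
    & w k * (l2 ^+ k * v k) = vV k].
    by near: k.
  have k0 : (0 < k)%N by near: k.
  have -> : l2 ^+ k = l2 * l2 ^+ k.-1 by rewrite -exprS prednK.
  by rewrite /xX; field.
have : q2 * s2 / l2 * (q2 * s2) <= 0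
  by apply: opposite_sign_limits sides wX wY.
have -> : q2 * s2 / l2 * (q2 * s2) = (q2 * s2) ^+ 2 / l2 by ring.
rewrite pmulr_lle0 ?invr_gt0 // real_exprn_even_le0 ?num_real //= mulf_eq0.
by rewrite (negPf q2_neq0) /= => /eqP.
Unshelve. all: by end_near.
Qed.

Hypothesis s_neq0 : s2 = 0 -> s1 <> 0.

Let s1_neq0 : s1 != 0. Proof. exact/eqP/s_neq0/s2_eq0. Qed.

Lemma uE : \forall k \near F, u k * E k = s1.
Proof. by apply: filterS u_eq => k ->; rewrite s2_eq0 mulr0 add0r. Qed.

Lemma vE : \forall k \near F, v k = c * (l1 ^+ k * u k).
Proof.
by apply: filterS fix_v => k ->; rewrite d_eq0 s2_eq0 mul0r !addr0.
Qed.

Lemma xYE : \forall k \near F,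
  xY k = x0 + u k * (q1 * l1 ^+ k + q2 * (c * (l1 * l2) ^+ k)).
Proof. by apply: filterS vE => k vk; rewrite /xY vk exprMn; ring. Qed.

Lemma xXE : \forall k \near F,
  xX k = x0 + u k * (q1 * l1 ^+ k.-1 + q2 * (c * (l1 * l2) ^+ k / l2)).
Proof.
near=> k; have -> : (l1 * l2) ^+ k = l1 ^+ k * (l2 * l2 ^+ k.-1).
  by rewrite exprMn -[in RHS]exprS prednK //; near: k.
by rewrite /xX (near vE k) //; field.
Unshelve. all: by end_near.
Qed.

(** Suppose l1 l2 <> 1.  Then b c (l1 l2)^k tends to 0, trivially if l1 l2 < 1,
    and because |b c| (l1 l2)^k <= 1 forces b c = 0 otherwise; so u_k tends to s1.
    By [xXE] and [xYE] the first coordinates of the two points are x0 plus terms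
    in l1^k and c (l1 l2)^k.  If these terms vanish in the limit, both points
    tend to x0, so x0 = 0 ([small_terms]); if instead the last term dominates,
    it has the same sign at both points ([large_v]).  The remaining cases, c = 0
    or l1 = 0, allow no sign change at all. *)
Lemma rho_eq1 : l1 * l2 = 1.
Proof.
apply/eqP/negPn/negP => rho1.
pose rk k := (l1 * l2) ^+ k.
pose w k := (l1 * l2)^-1 ^+ k.
pose bcr k := b * c * rk k.
have bc_rho : bcr k @[k --> F] --> 0.
  rewrite /bcr.
  have [rho_lt1|] := ltP (l1 * l2) 1.
    have cvg_rho : rk k @[k --> F] --> 0 := cvg_expr_along Foo rho_ge0 rho_lt1.
    have -> : 0 = b * c * 0 :> R by ring.
    by solve_cvg.
  rewrite le_eqVlt eq_sym (negPf rho1) /= => rho_gt1.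
  have rho_gt0 := lt_trans ltr01 rho_gt1.
  have -> : b * c = 0.
    apply/eqP; rewrite -normr_le0.
    have rhoV_ge0 : 0 <= (l1 * l2)^-1 by rewrite invr_ge0.
    have rhoV_lt1 : (l1 * l2)^-1 < 1 by rewrite invf_lt1.
    apply: (cvgr_to_ge (cvg_expr_along Foo rhoV_ge0 rhoV_lt1)); near=> k.
    have : `|det k| <= 1 by near: k.
    rewrite /det d_eq0 mulr0 sub0r normrM normrN.
    rewrite [X in _ * X]ger0_norm ?exprn_ge0 //.
    by rewrite -ler_pdivlMr ?exprn_gt0 // mul1r exprVn.
  by under eq_cvg do rewrite mul0r; exact: cvg_cst.
have cvg_u : u k @[k --> F] --> s1.
  rewrite -[s1]divr1; apply: (cvg_quotient (oner_neq0 R) uE).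
  have -> : 1 = 1 - a * 0 - 0 :> R by ring.
  change (1 - a * l1 ^+ k - bcr k @[k --> F] --> 1 - a * 0 - 0).
  by solve_cvg.
pose crk k := c * rk k.
have small_terms : crk k @[k --> F] --> 0 -> x0 = 0.
  move=> c_rho; have lY : 1 * xY k @[k --> F] --> x0.
    apply: cvg_trans (_ : x0 + u k * (q1 * l1 ^+ k + q2 * crk k)
      @[k --> F] --> _).
      by apply: near_eq_cvg; apply: filterS xYE => k ->; rewrite mul1r.
    apply: (@cvg_limit_eq _ _ _ (x0 + s1 * (q1 * 0 + q2 * 0))); first by ring.
    by solve_cvg.
  have lX : 1 * xX k @[k --> F] --> x0.
    apply: cvg_trans (_ : x0 + u k * (q1 * l1 ^+ k.-1 + q2 * (crk k / l2))
      @[k --> F] --> _).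
      by apply: near_eq_cvg; apply: filterS xXE => k ->; rewrite mul1r.
    apply: (@cvg_limit_eq _ _ _ (x0 + s1 * (q1 * 0 + q2 * (0 / l2)))).
      by ring.
    by solve_cvg.
  apply/eqP; rewrite -sqrf_eq0 eq_le sqr_ge0 andbT.
  by apply: opposite_sign_limits sides lX lY.
pose x0w k := x0 * w k.
have large_v : c != 0 -> l1 != 0 -> x0w k @[k --> F] --> 0 -> False.
  move=> c0 l10 x0_rho.
  have w_rho k : w k * rk k = 1.
    by rewrite /w /rk -exprMn mulVf ?expr1n // mulf_neq0.
  have w_l1 k : w k * l1 ^+ k = l2^-1 ^+ k.
    by rewrite /w -exprMn invfM mulrAC mulVf // mul1r.
  have lY : w k * xY k @[k --> F] --> s1 * (q2 * c).
    apply: cvg_trans (_ : x0w k + u k * (q1 * l2^-1 ^+ k + q2 * c)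
      @[k --> F] --> _).
      apply: near_eq_cvg; apply: filterS xYE => k ->.
      rewrite -w_l1 -[c in LHS]mulr1 -(w_rho k).
      by rewrite /x0w /rk; ring.
    have -> : s1 * (q2 * c) = 0 + s1 * (q1 * 0 + q2 * c) by ring.
    by solve_cvg.
  have lX : w k * xX k @[k --> F] --> s1 * (q2 * c) / l2.
    apply: cvg_trans (_ : x0w k + u k * (q1 * l2^-1 ^+ k / l1 + q2 * c / l2)
      @[k --> F] --> _).
      apply: near_eq_cvg; near=> k; have k_gt : (0 < k)%N by near: k.
      rewrite (near xXE k) // -w_l1 -[c in LHS]mulr1 -(w_rho k).
      have -> : l1 ^+ k = l1 * l1 ^+ k.-1 by rewrite -exprS prednK.
      by rewrite /x0w /rk; field; rewrite l2_neq0.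
    have -> : s1 * (q2 * c) / l2 = 0 + s1 * (q1 * 0 / l1 + q2 * c / l2) by ring.
    by solve_cvg.
  have : s1 * (q2 * c) / l2 * (s1 * (q2 * c)) <= 0.
    by apply: opposite_sign_limits sides lX lY.
  have -> : s1 * (q2 * c) / l2 * (s1 * (q2 * c)) =
    (s1 * (q2 * c)) ^+ 2 / l2 by ring.
  rewrite pmulr_lle0 ?invr_gt0 // exprn_even_le0 //= !mulf_eq0.
  by rewrite (negPf q2_neq0) (negPf c0) (negPf s1_neq0).
have [k [kXY k_gt kX kY]] : exists k, [/\ xX k * xY k < 0, (0 < k)%N,
    xX k = x0 + u k * (q1 * l1 ^+ k.-1 + q2 * (c * (l1 * l2) ^+ k / l2)) &
    xY k = x0 + u k * (q1 * l1 ^+ k + q2 * (c * (l1 * l2) ^+ k))].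
  apply: (@filter_ex _ F); near=> k.
  by split; near: k => //; [exact: xXE | exact: xYE].
have [c0|c0] := eqVneq c 0.
  have x00 : x0 = 0.
    apply: small_terms; rewrite /crk c0.
    by under eq_cvg do rewrite mul0r; exact: cvg_cst.
  move: kXY; rewrite kX kY x00 c0 !(mul0r, mulr0, addr0, add0r).
  have -> : l1 ^+ k = l1 * l1 ^+ k.-1 by rewrite -exprS prednK.
  have -> : u k * (q1 * l1 ^+ k.-1) * (u k * (q1 * (l1 * l1 ^+ k.-1))) =
    l1 * (u k * (q1 * l1 ^+ k.-1)) ^+ 2 by ring.
  by rewrite ltNge mulr_ge0 // sqr_ge0.
have [l10|l10] := eqVneq l1 0.
  have x00 : x0 = 0.
    apply: small_terms.
    rewrite /crk; have -> : 0 = c * 0 :> R by ring.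
    apply: cvgM; first exact: cvg_cst.
    apply: cvg_trans cvg_l1; apply: near_eq_cvg; near=> j.
    by rewrite /rk l10 mul0r.
  move: kXY; rewrite kY x00 l10 mul0r !expr0n -[k == 0%N]negbK -lt0n k_gt /=.
  by rewrite !(mul0r, mulr0, addr0, add0r) ltxx.
apply: large_v => //.
have [rho_lt1|] := ltP (l1 * l2) 1.
  rewrite /x0w; have -> : x0 = 0.
    apply: small_terms.
    have cvg_rho : rk k @[k --> F] --> 0 := cvg_expr_along Foo rho_ge0 rho_lt1.
    rewrite /crk; have -> : 0 = c * 0 :> R by ring.
    by solve_cvg.
  by under eq_cvg do rewrite mul0r; exact: cvg_cst.
rewrite le_eqVlt eq_sym (negPf rho1) /= => rho_gt1.
have rhoV_ge0 : 0 <= (l1 * l2)^-1 by rewrite invr_ge0.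
have rhoV_lt1 : (l1 * l2)^-1 < 1 by rewrite invf_lt1 // (lt_trans ltr01).
have cvg_rho : w k @[k --> F] --> 0 := cvg_expr_along Foo rhoV_ge0 rhoV_lt1.
rewrite /x0w; have -> : 0 = x0 * 0 :> R by ring.
by solve_cvg.
Unshelve. all: by end_near.
Qed.

(** If b c = 1, then the determinant is -1, so the trace a l1^k vanishes by
    [power_bounded_trace_det]; then E_k = 0 and u_k E_k = s1 gives s1 = 0. *)
Lemma bc_neq1 : 1 - b * c != 0.
Proof.
have [k [kE kt]] : exists k, u k * E k = s1 /\ tr k ^+ 2 <= 2 + 2 * det k.
  by apply: (@filter_ex _ F); near=> k; split; near: k => //; exact: uE.
apply: contra_neq s1_neq0 => bc1; rewrite -kE /E.
have {bc1} bc1 : b * c = 1 by apply/eqP; rewrite eq_sym -subr_eq0 bc1.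
move: kt; rewrite /tr /det rho_eq1 d_eq0 bc1 expr1n.
rewrite mulr0 mul0r addr0 sub0r mulr1 mulrN1 subrr exprn_even_le0 //=.
by move=> /eqP ->; rewrite subr0 mul1r subrr mulr0.
Unshelve. all: by end_near.
Qed.

End ReturnMaps.

(** * Coordinates along the eigenvectors of the X-cycle *)

Section Coordinates.
Variables (R : realType) (p : bcnf R) (X Y : word) (l1 l2 : R).
Variables (zeta1 zeta2 z0 : 'cV[R]_2).
Hypothesis l1_neq_l2 : l1 != l2.
Hypothesis zeta1P : is_eigenvector (Mword p X) l1 zeta1.
Hypothesis zeta2P : is_eigenvector (Mword p X) l2 zeta2.
Notation pt := 'cV[R]_2.
Notation Q := (Qmx zeta1 zeta2).

Definition uv_point (u v : R) : pt := z0 + (u *: zeta1 + v *: zeta2).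

Lemma of_uvE w : of_uv Q z0 w = uv_point (xcoord w) (ycoord w).
Proof. by rewrite /of_uv /Qmx mul_row_mx2 addrC. Qed.

Lemma xcoord_mkpoint (x y : R) : xcoord (mkpoint x y) = x.
Proof. by rewrite /xcoord mxE. Qed.

Lemma ycoord_mkpoint (x y : R) : ycoord (mkpoint x y) = y.
Proof. by rewrite /ycoord mxE. Qed.

Lemma Q_mkpoint (u v : R) : u *: zeta1 + v *: zeta2 = Q *m mkpoint u v.
Proof. by rewrite /Qmx mul_row_mx2 xcoord_mkpoint ycoord_mkpoint. Qed.

Lemma eigenvectors_free (u v : R) :
  u *: zeta1 + v *: zeta2 = 0 -> u = 0 /\ v = 0.
Proof.
case: zeta1P zeta2P => [z10 Mz1] [z20 Mz2] uv0.
have Muv0 : (u * l1) *: zeta1 + (v * l2) *: zeta2 = 0.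
  by rewrite -!scalerA -Mz1 -Mz2 !scalemxAr -mulmxDr uv0 mulmx0.
have v0 : v = 0.
  apply/eqP; have : (v * (l2 - l1)) *: zeta2 = 0.
    rewrite mulrBr scalerBl; apply/eqP; rewrite subr_eq0; apply/eqP.
    apply: (addrI ((u * l1) *: zeta1)); rewrite Muv0 ![_ * l1]mulrC -!scalerA.
    by rewrite -scalerDr uv0 scaler0.
  move/eqP; rewrite scaler_eq0 (negPf z20) orbF mulf_eq0 subr_eq0.
  by rewrite (eq_sym l2) (negPf l1_neq_l2) orbF.
split=> //; apply/eqP; move/eqP: uv0; rewrite v0 scale0r addr0 scaler_eq0.
by rewrite (negPf z10) orbF.
Qed.

Lemma unitmx_Q : Q \in unitmx.
Proof.
rewrite -unitmx_tr unitmxE unitfE; apply/negP => /det0P[r r0 rQ].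
have /eigenvectors_free[u0 v0] :
    xcoord r^T *: zeta1 + ycoord r^T *: zeta2 = 0.
  by rewrite -mul_row_mx2 -[RHS]trmx0 -rQ trmx_mul trmxK.
case/eqP: r0; apply/rowP; apply: ord2P; rewrite mxE.
  by move: u0; rewrite /xcoord mxE.
by move: v0; rewrite /ycoord mxE.
Qed.

Lemma to_uv_point (u v : R) : to_uv Q z0 (uv_point u v) = mkpoint u v.
Proof.
rewrite /to_uv /uv_point addrAC subrr add0r.
by rewrite Q_mkpoint mulKmx // unitmx_Q.
Qed.

Lemma uv_pointK (z : pt) :
  uv_point (xcoord (to_uv Q z0 z)) (ycoord (to_uv Q z0 z)) = z.
Proof. by rewrite -of_uvE /of_uv /to_uv mulKVmx ?subrK // unitmx_Q. Qed.

Lemma uv_point_inj (u v u' v' : R) :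
  uv_point u v = uv_point u' v' -> u = u' /\ v = v'.
Proof.
move=> /(congr1 (to_uv Q z0)); rewrite !to_uv_point => e.
by split; [rewrite -(xcoord_mkpoint u v) e xcoord_mkpoint
          | rewrite -(ycoord_mkpoint u v) e ycoord_mkpoint].
Qed.

Lemma xcoord_uv_point (u v : R) :
  xcoord (uv_point u v) = xcoord z0 + xcoord zeta1 * u + xcoord zeta2 * v.
Proof. by rewrite /xcoord !mxE addrA (mulrC u) (mulrC v). Qed.

(** In the (u, v)-coordinates, g^Y is the affine map w |-> Ymx w + Yshift. *)
Definition Ymx : 'M[R]_2 := invmx Q *m Mword p Y *m Q.
Definition Yshift : pt := to_uv Q z0 (fword p Y z0).

Notation a := (Ymx ord0 ord0).
Notation b := (Ymx ord0 ord_max).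
Notation c := (Ymx ord_max ord0).
Notation d := (Ymx ord_max ord_max).
Notation s1 := (xcoord Yshift).
Notation s2 := (ycoord Yshift).

Lemma fword_uv S (u v : R) : fword p S (uv_point u v) =
  fword p S z0 + (u *: (Mword p S *m zeta1) + v *: (Mword p S *m zeta2)).
Proof. by rewrite fwordD mulmxDr !scalemxAr. Qed.

Lemma fword_Y_uv (u v : R) : fword p Y (uv_point u v) =
  uv_point (a * u + b * v + s1) (c * u + d * v + s2).
Proof.
rewrite fwordD -(uv_pointK (fword p Y z0)) /uv_point -addrA; congr (_ + _).
rewrite (Q_mkpoint u v).
have -> : Mword p Y *m (Q *m mkpoint u v) = Q *m (Ymx *m mkpoint u v).
  by rewrite /Ymx !mulmxA mulmxV ?unitmx_Q // mul1mx.
rewrite /Qmx mul_row_mx2 addrACA -!scalerDl.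
congr (_ *: _ + _ *: _); rewrite addrC; congr (_ + _).
  by rewrite /xcoord mxE sum2 !mxE.
by rewrite /ycoord mxE sum2 !mxE.
Qed.

Lemma gword_Y w :
  ycoord (gword p Q z0 Y w) = c * xcoord w + d * ycoord w + s2.
Proof. by rewrite /gword of_uvE fword_Y_uv to_uv_point ycoord_mkpoint. Qed.

Lemma Mword_X_expr k : Mword p X ^+ k *m zeta1 = l1 ^+ k *: zeta1 /\
  Mword p X ^+ k *m zeta2 = l2 ^+ k *: zeta2.
Proof.
have [_ M1] := zeta1P; have [_ M2] := zeta2P.
elim: k => [|k [IH1 IH2]]; first by rewrite !expr0 !mul1mx !scale1r.
rewrite !exprSr -!mulmxA M1 M2 -!scalemxAr IH1 IH2 !scalerA.
by rewrite !(mulrC _ (_ ^+ k)).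
Qed.

Definition diag2 (x y : R) : 'M[R]_2 :=
  row_mx (mkpoint x 0) (mkpoint 0 y) : 'M[R]_(2, 1 + 1).

Lemma Mword_XkY_conj k :
  invmx Q *m Mword p (XkY X Y k) *m Q = Ymx *m diag2 (l1 ^+ k) (l2 ^+ k).
Proof.
rewrite Mword_cat Mword_wpow /Ymx -!mulmxA; congr (_ *m (_ *m _)).
have [M1 M2] := Mword_X_expr k.
apply: etrans (@mul_mx_row _ 2 2 1 1 _ _ _) _; rewrite M1 M2.
apply: etrans (esym (@mul_mx_row _ 2 2 1 1 _ _ _)); rewrite /Qmx !mul_row_mx2.
by rewrite !xcoord_mkpoint !ycoord_mkpoint !scale0r addr0 add0r.
Qed.

Lemma det_Mword_XkY k :
  \det (Mword p (XkY X Y k)) = (a * d - b * c) * (l1 * l2) ^+ k.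
Proof.
have -> : \det (Mword p (XkY X Y k)) =
    \det (invmx Q *m Mword p (XkY X Y k) *m Q).
  rewrite -mulmxA det_mulmx det_mulmx mulrCA -det_mulmx mulVmx ?unitmx_Q //.
  by rewrite det1 mulr1.
rewrite Mword_XkY_conj det_mulmx !det2 exprMn; congr (_ * _).
rewrite /diag2 !(row_mx2E _ _ _).1 !(row_mx2E _ _ _).2 !mxE /=.
by rewrite mulr0 subr0.
Qed.

Lemma trace_Mword_XkY k :
  \tr (Mword p (XkY X Y k)) = a * l1 ^+ k + d * l2 ^+ k.
Proof.
have -> : \tr (Mword p (XkY X Y k)) =
    \tr (invmx Q *m Mword p (XkY X Y k) *m Q).
  by rewrite -mulmxA mxtrace_mulC -mulmxA mulmxV ?unitmx_Q // mulmx1.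
rewrite Mword_XkY_conj; move: Ymx => B; rewrite mxtrace2 !mxE !sum2.
rewrite /diag2 !(row_mx2E _ _ _).1 !(row_mx2E _ _ _).2 !mxE /=.
by rewrite !mulr0 addr0 add0r.
Qed.

(** If zeta2 were vertical, translating the v-axis by - z0 would give the
    switching manifold. *)
Lemma v_axis_not_vertical :
  ~ parallel (of_uv Q z0 @` @v_axis R) (@switching_manifold R) ->
  xcoord zeta2 != 0.
Proof.
move=> npar; apply/negP => /eqP x0; apply: npar; exists (- z0).
have [z20 _] := zeta2P.
have y0 : ycoord zeta2 != 0.
  apply: contra_neq z20 => y0; apply/colP; apply: ord2P; rewrite mxE //.
apply/seteqP; split=> [z zx|z [w [w' w'v <-] <-]]; last first.
  rewrite of_uvE /uv_point addrAC subrr add0r w'v scale0r add0r.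
  by rewrite /switching_manifold /= /xcoord mxE [zeta2 _ _]x0 mulr0.
exists (uv_point 0 (ycoord z / ycoord zeta2)).
  exists (mkpoint 0 (ycoord z / ycoord zeta2)).
    by rewrite /v_axis /= xcoord_mkpoint.
  by rewrite of_uvE xcoord_mkpoint ycoord_mkpoint.
rewrite /uv_point addrAC subrr add0r scale0r add0r.
apply/colP; apply: ord2P; rewrite mxE.
  by rewrite [zeta2 _ _]x0 mulr0; symmetry.
by rewrite mulfVK.
Qed.

(** Write f^X(z0) as z0 + t1 zeta1 + t2 zeta2; along each eigenvector the equation
    for a fixed point is then scalar, t + l u = u. *)
Lemma fword_X_fixed_point : l1 != 1 -> l2 != 1 -> exists w, fword p X w = w.
Proof.
move=> l1n l2n; have [M1 M2] := Mword_X_expr 1.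
have : fword p X z0 = uv_point (xcoord (to_uv Q z0 (fword p X z0)))
  (ycoord (to_uv Q z0 (fword p X z0))) by rewrite uv_pointK.
set t1 := xcoord _; set t2 := ycoord _ => tE.
exists (uv_point (t1 / (1 - l1)) (t2 / (1 - l2))).
rewrite fword_uv tE -[Mword p X]expr1 M1 M2 !expr1 !scalerA /uv_point -addrA.
congr (_ + _); rewrite addrACA -!scalerDl.
by congr (_ *: _ + _ *: _); field; rewrite subr_eq0 eq_sym.
Qed.

Hypothesis z0_fixed : fword p X z0 = z0.

Lemma fword_wpow_uv k (u v : R) : fword p (wpow k X) (uv_point u v) =
  uv_point (l1 ^+ k * u) (l2 ^+ k * v).
Proof.
have [M1 M2] := Mword_X_expr k.
rewrite fword_uv Mword_wpow M1 M2 !scalerA !(mulrC _ (_ ^+ k)); congr (_ + _).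
by elim: (k) => // n IH; rewrite wpowS fword_cat z0_fixed.
Qed.

Section Cycle.
Variables (k : nat) (z : int -> pt).
Hypothesis zP : is_cycle p (XkY X Y k) z.
Let u := xcoord (to_uv Q z0 (z 0)).
Let v := ycoord (to_uv Q z0 (z 0)).

(** The cycle of X^k Y seen inside its j-th copy of X. *)
Lemma cycle_block j r : (j < k)%N -> (r <= size X)%N ->
  z (j * size X + r)%N%:Z =
  fword p (take r X) (uv_point (l1 ^+ j * u) (l2 ^+ j * v)).
Proof.
move=> jk rX; rewrite (cycle_prefix zP); last first.
  rewrite size_XkY (leq_trans _ (leq_addr _ _)) //.
  by apply: leq_trans (leq_mul jk (leqnn (size X))); rewrite mulSnr leq_add2l.
by rewrite take_XkY_block // fword_cat -(uv_pointK (z 0)) fword_wpow_uv.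
Qed.

Lemma cycle_tail i : (i <= size Y)%N ->
  z (k * size X + i)%N%:Z =
  fword p (take i Y) (uv_point (l1 ^+ k * u) (l2 ^+ k * v)).
Proof.
move=> iY; rewrite (cycle_prefix zP) ?size_XkY ?leq_add2l //.
by rewrite take_XkY_tail fword_cat -(uv_pointK (z 0)) fword_wpow_uv.
Qed.

Lemma cycle_fixed_uv :
  u = a * (l1 ^+ k * u) + b * (l2 ^+ k * v) + s1 /\
  v = c * (l1 ^+ k * u) + d * (l2 ^+ k * v) + s2.
Proof.
apply: uv_point_inj; rewrite uv_pointK -fword_Y_uv -fword_wpow_uv -fword_cat.
by rewrite uv_pointK (cycle_fixed zP).
Qed.

End Cycle.

(** * The limit orbit *)

Lemma cvg_fword_uv (F : set_system nat) (FF : Filter F) S (f g : nat -> R)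
    (u v : R) :
  f k @[k --> F] --> u -> g k @[k --> F] --> v ->
  fword p S (uv_point (f k) (g k)) @[k --> F] --> fword p S (uv_point u v).
Proof.
move=> fu gv; rewrite fword_uv; under eq_cvg do rewrite fword_uv.
apply: cvgD; first exact: cvg_cst.
by apply: cvgD; apply: cvgZr_tmp.
Qed.

(** Index 0 is the point (0, v) from which the block Y is traversed.  After Y the
    orbit contracts along the u-axis from (u, 0), by l1 at each traversal of X.
    Before index 0 it lies on the v-axis, and each traversal of X backwards
    divides by l2 = l1^-1; the index - (n + 1) with n = q n_X + s is reached from
    (0, l1^(q + 1) v) after n_X - 1 - s symbols of X. *)
Definition limit_orbit (u v : R) (i : int) : pt :=
  match i with
  | Posz n => if (n < size Y)%N then fword p (take n Y) (uv_point 0 v) else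
      fword p (take ((n - size Y) %% size X) X)
        (uv_point (l1 ^+ ((n - size Y) %/ size X) * u) 0)
  | Negz n => fword p (take ((size X).-1 - n %% size X) X)
      (uv_point 0 (l1 ^+ (n %/ size X).+1 * v))
  end.

Hypothesis X_gt0 : (0 < size X)%N.
Hypotheses (l1_ge0 : 0 <= l1) (l1_lt1 : l1 < 1) (l12 : l1 * l2 = 1).

Let l1_neq0 : l1 != 0.
Proof.
by apply/eqP => l10; have /eqP := l12; rewrite l10 mul0r eq_sym oner_eq0.
Qed.

Section Convergence.
Variables (F : set_system nat) (z : nat -> int -> pt) (c u : R).
Context {FF : ProperFilter F}.
Hypothesis Foo : F --> \oo.
Hypothesis z_cycle : \forall k \near F, is_cycle p (XkY X Y k) (z k).
Let u_ k := xcoord (to_uv Q z0 (z k 0)).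
Let v_ k := ycoord (to_uv Q z0 (z k 0)).
Hypothesis u_cvg : u_ k @[k --> F] --> u.
Hypothesis v_E : \forall k \near F, v_ k = c * (l1 ^+ k * u_ k).

Let cvg_l1 := cvg_expr_along Foo l1_ge0 l1_lt1.

Let near_gt m : \forall k \near F, (m < k)%N.
Proof. exact: Foo (nbhs_infty_gt m). Qed.

Lemma cvg_l1u : l1 ^+ k * u_ k @[k --> F] --> 0.
Proof. by rewrite -(mul0r u); apply: cvgM. Qed.

(** This is where l1 l2 = 1 balances the two directions. *)
Lemma near_l2v : \forall k \near F, l2 ^+ k * v_ k = c * u_ k.
Proof.
apply: filterS v_E => k ->; rewrite mulrCA (mulrA (l2 ^+ k)) -exprMn.
by rewrite (mulrC l2) l12 expr1n mul1r.
Qed.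

Lemma cvg_l2v : l2 ^+ k * v_ k @[k --> F] --> c * u.
Proof.
apply: cvg_trans (_ : c * u_ k @[k --> F] --> _).
  by apply: near_eq_cvg; apply: filterS near_l2v => k ->.
by apply: cvgM => //; exact: cvg_cst.
Qed.

Lemma cvg_v : v_ k @[k --> F] --> 0.
Proof.
apply: cvg_trans (_ : c * (l1 ^+ k * u_ k) @[k --> F] --> _).
  by apply: near_eq_cvg; apply: filterS v_E => k ->.
by rewrite -(mulr0 c); apply: cvgM; [exact: cvg_cst | exact: cvg_l1u].
Qed.

Lemma cvg_forward q r : (r <= size X)%N ->
  z k (q * size X + r)%N%:Z @[k --> F] -->
  fword p (take r X) (uv_point (l1 ^+ q * u) 0).
Proof.
move=> rX; apply: cvg_trans (_ : fword p (take r X)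
    (uv_point (l1 ^+ q * u_ k) (l2 ^+ q * v_ k)) @[k --> F] --> _).
  apply: near_eq_cvg; near=> k.
  have zk : is_cycle p (XkY X Y k) (z k) by near: k.
  by rewrite (cycle_block zk) //; near: k; exact: near_gt.
apply: cvg_fword_uv; first by apply: cvgM => //; exact: cvg_cst.
by rewrite -(mulr0 (l2 ^+ q)); apply: cvgM; [exact: cvg_cst | exact: cvg_v].
Unshelve. all: by end_near.
Qed.

(** For i < 0 the point lies in one of the last copies of X, for 0 <= i < n_Y in
    the block Y, and for i >= n_Y it is, by periodicity, in one of the first
    copies of X; in each case it is the image under a word that does not depend
    on k of a point with convergent coordinates. *)
Lemma cvg_limit_orbit i :
  z k ((k * size X)%N%:Z + i) @[k --> F] --> limit_orbit u (c * u) i.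
Proof.
case: i => n; rewrite /limit_orbit; last first.
  set q := (n %/ size X)%N; set s := (n %% size X)%N.
  have sX : (s < size X)%N by rewrite ltn_mod.
  have nE : n = (q * size X + s)%N by apply: divn_eq.
  apply: cvg_trans (_ : fword p (take ((size X).-1 - s) X)
      (uv_point (l1 ^+ (k - q.+1) * u_ k) (l2 ^+ (k - q.+1) * v_ k))
      @[k --> F] --> _).
    apply: near_eq_cvg; near=> k.
    have qk : (q < k)%N by near: k; exact: near_gt.
    have zk : is_cycle p (XkY X Y k) (z k) by near: k.
    rewrite -(cycle_block zk); [|by rewrite ltn_subrL (leq_ltn_trans _ qk)|].
      have kE : (k * size X = (k - q.+1) * size X + (q * size X + size X))%N.
        by rewrite -mulSnr -mulnDl subnK.
      congr (z k _); rewrite NegzE nE kE.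
      by move: (_ * _)%N (_ * _)%N => A B; lia.
    by rewrite (leq_trans (leq_subr _ _)) // leq_pred.
  have l1q : l1 ^+ q.+1 != 0 by rewrite expf_neq0.
  apply: cvg_fword_uv.
    apply: cvg_trans (_ : (l1 ^+ q.+1)^-1 * (l1 ^+ k * u_ k) @[k --> F] --> _).
      apply: near_eq_cvg; near=> k.
      have qk : (q < k)%N by near: k; exact: near_gt.
      by rewrite -{1}(subnKC qk) exprD -(mulrA (l1 ^+ q.+1)) mulKf.
    rewrite -(mulr0 (l1 ^+ q.+1)^-1).
    by apply: cvgM; [exact: cvg_cst | exact: cvg_l1u].
  apply: cvg_trans (_ : l1 ^+ q.+1 * (c * u_ k) @[k --> F] --> _).
    apply: near_eq_cvg; near=> k.
    have qk : (q < k)%N by near: k; exact: near_gt.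
    have <- : l2 ^+ k * v_ k = c * u_ k by near: k; exact: near_l2v.
    rewrite -{1}(subnKC qk) exprD !mulrA -exprMn l12 expr1n mul1r //.
  by apply: cvgM; [exact: cvg_cst | apply: cvgM => //; exact: cvg_cst].
case: ltnP => nY.
  apply: cvg_trans (_ : fword p (take n Y)
      (uv_point (l1 ^+ k * u_ k) (l2 ^+ k * v_ k)) @[k --> F] --> _).
    apply: near_eq_cvg; near=> k.
    have zk : is_cycle p (XkY X Y k) (z k) by near: k.
    by rewrite -PoszD (cycle_tail zk) // ltnW.
  by apply: cvg_fword_uv; [exact: cvg_l1u | exact: cvg_l2v].
set m := (n - size Y)%N.
have mX : (m %% size X <= size X)%N by rewrite ltnW ?ltn_pmod.
have := @cvg_forward (m %/ size X) _ mX; apply: cvg_trans.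
apply: near_eq_cvg; near=> k; rewrite -divn_eq.
have zk : is_cycle p (XkY X Y k) (z k) by near: k.
by case: zk => <- _; congr (z k _); rewrite size_XkY /m; lia.
Unshelve. all: by end_near.
Qed.

End Convergence.

Section Homoclinic.
Variable x : int -> pt.
Hypothesis xP : is_cycle p X x.
Hypothesis x0 : x 0 = z0.

Lemma cycle_X_prefix r : (r <= size X)%N -> x r%:Z = fword p (take r X) z0.
Proof. by move=> rX; rewrite (cycle_prefix xP) // x0. Qed.

Lemma prefix_bounded (h : pt) : exists C,
  forall r, (r < size X)%N -> `|Mword p (take r X) *m h| <= C.
Proof.
exists (\sum_(r < size X) `|Mword p (take r X) *m h|) => r rX.
by rewrite (bigD1 (Ordinal rX)) //= lerDl sumr_ge0.
Qed.

Lemma set_dist_cycle (z : pt) i : 0 <= set_dist z (range x) <= `|z - x i|.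
Proof.
have lb0 : lbound [set `|z - a| | a in range x] 0 by move=> _ [a _ <-].
apply/andP; split; last first.
  by apply: ge_inf; [exists 0 | exists (x i) => //; exists i].
by apply: lb_le_inf => //; exists `|z - x i|; exists (x i) => //; exists i.
Qed.

(** A point that differs from the base point of the X-cycle by l1^q h is still
    within a constant times l1^q of the cycle after fewer than n_X further
    symbols of X. *)
Lemma cvg_set_dist0 (z : nat -> pt) (h : pt) (r q : nat -> nat) :
  (forall n, r n < size X)%N -> q @ \oo --> \oo ->
  (\forall n \near \oo, z n =
    fword p (take (r n) X) (z0 + l1 ^+ q n *: h)) ->
  (fun n => set_dist (z n) (range x)) @ \oo --> (0 : R).
Proof.
move=> rX qoo zE; have [C hC] := prefix_bounded h.
apply: (@squeeze_cvgr _ _ _ _ (cst 0) (fun n => l1 ^+ q n * C)).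
- near=> n; have /andP[-> le_d] := set_dist_cycle (z n) (r n)%:Z.
  apply: le_trans le_d _; rewrite cycle_X_prefix 1?ltnW //.
  have -> : z n = fword p (take (r n) X) (z0 + l1 ^+ q n *: h) by near: n.
  rewrite fwordD addrAC subrr add0r -scalemxAr normrZ ger0_norm ?exprn_ge0 //.
  by rewrite ler_wpM2l ?exprn_ge0 // hC.
- exact: cvg_cst.
- rewrite -(mul0r C); apply: cvgM; last exact: cvg_cst.
  have l1_0 : l1 ^+ k @[k --> \oo] --> 0.
    by apply: (@cvg_expr R); rewrite ger0_norm.
  exact: cvg_comp qoo l1_0.
Unshelve. all: by end_near.
Qed.

Lemma limit_orbit_forward u v :
  (fun n : nat => set_dist (limit_orbit u v n%:Z) (range x)) @ \oo --> (0 : R).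
Proof.
pose m n := (n - size Y)%N.
apply: (@cvg_set_dist0 _ (u *: zeta1) (fun n => m n %% size X)%N
  (fun n => m n %/ size X)%N).
- by move=> n; rewrite ltn_mod.
- exact: (@cvg_comp _ _ _ _ _ _ _ _ (cvg_subnr (size Y)) (cvg_divnr _ X_gt0)).
- near=> n; rewrite /limit_orbit ltnNge ifF; last first.
    by apply/negbF; near: n; exact: nbhs_infty_ge.
  by rewrite /uv_point scale0r addr0 scalerA.
Unshelve. all: by end_near.
Qed.

Lemma limit_orbit_backward u v :
  (fun n : nat => set_dist (limit_orbit u v (- n%:Z)) (range x)) @ \oo
  --> (0 : R).
Proof.
apply: (@cvg_set_dist0 _ (v *: zeta2)
  (fun n => (size X).-1 - n.-1 %% size X)%N (fun n => (n.-1 %/ size X).+1)%N).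
- by move=> n; rewrite (leq_ltn_trans (leq_subr _ _)) // ltn_predL.
- apply/cvgnyPge => A; near=> n.
  apply: leq_trans (leqnSn _); rewrite leq_divRL // -ltnS.
  by rewrite (leq_trans _ (leqSpred _)) //; near: n; exact: nbhs_infty_gt.
- near=> n; have n0 : (0 < n)%N by near: n; exact: nbhs_infty_gt.
  rewrite -{1}(prednK n0) -NegzE /limit_orbit.
  by rewrite /uv_point scale0r add0r scalerA.
Unshelve. all: by end_near.
Qed.

Lemma admissible_is_orbit : admissible X x -> is_orbit p x.
Proof.
by move=> adm i; rewrite xP.2 (@bcmap_fhalf _ p (symbol_at X i) (x i) (adm i)).
Qed.

(** Otherwise the point (u, 0) of the orbit, lying on the X-cycle, would return
    to itself after n_X steps, whereas it moves to (l1 u, 0). *)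
Lemma limit_orbit_not_in_cycle u v : u != 0 ->
  admissible X x -> is_orbit p (limit_orbit u v) ->
  ~ (range (limit_orbit u v) `<=` range x).
Proof.
move=> u0 adm orb sub.
have iter_orbit (w : int -> pt) : is_orbit p w ->
    forall i n, w (i + n%:Z) = iter n (bcmap p) (w i).
  move=> worb i; elim=> [|n IH]; first by rewrite addr0.
  by rewrite iterS -IH -worb -addrA -PoszD addn1.
have zE q : limit_orbit u v (size Y + q * size X)%N%:Z =
    uv_point (l1 ^+ q * u) 0.
  rewrite /limit_orbit ltnNge leq_addr /= addKn modnMl mulnK // take0 //.
have [i _ xi] := sub _ (imageT (limit_orbit u v) (size Y)%:Z).
have := zE 1; rewrite mul1n PoszD iter_orbit // -xi -iter_orbit; last first.
  exact: admissible_is_orbit.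
rewrite xP.1 xi; have := zE 0; rewrite mul0n addn0 => ->.
move=> /uv_point_inj[+ _]; rewrite expr0 expr1 mul1r => /eqP.
rewrite -subr_eq0 -{1}[u]mul1r -mulrBl mulf_eq0 (negPf u0) orbF subr_eq0.
by move=> /eqP l11; move: l1_lt1; rewrite -l11 ltxx.
Qed.

Lemma admissible_from_prefix :
  (forall r, (r < size X)%N -> match symbol_at X r%:Z with
     | symL => xcoord (fword p (take r X) z0) <= 0
     | symR => 0 <= xcoord (fword p (take r X) z0)
     end) -> admissible X x.
Proof.
move=> adm i; rewrite (divz_eq i (size X)) addrC (cycle_periodic xP).
have -> : symbol_at X ((i %% size X)%Z + (i %/ size X)%Z * size X) =
    symbol_at X (i %% size X)%Z by rewrite /symbol_at addrC modzMDl.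
have X0 : (size X)%:Z != 0 by rewrite -lt0n.
have := ltz_mod i X0; have := modz_ge0 i X0.
case: (i %% size X)%Z => // r _; rewrite ltz_nat absz_nat => rX.
by rewrite cycle_X_prefix 1?ltnW //; apply: adm.
Qed.

End Homoclinic.

End Coordinates.

(** * Infinite sets of indices and continuity of the map *)

Section Limits.
Variable R : realType.

Lemma infinite_within_proper (K : set nat) :
  infinite_set K -> ProperFilter (within K \oo).
Proof.
move=> Kinf; apply: Build_ProperFilter => -[N _ KN]; apply: Kinf.
apply: (@sub_finite_set _ _ `I_N) => // n Kn /=; rewrite ltnNge.
by apply/negP => Nn; exact: KN Nn Kn.
Qed.

Lemma near_within_all (K P : set nat) :
  (forall k, K k -> P k) -> \forall k \near within K \oo, P k.
Proof. by move=> KP; exists 0%N => // k _ Kk; exact: KP. Qed.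

Lemma cvg_within_sub (T : topologicalType) (K U : set nat) (f : nat -> T)
    (l : T) :
  K `<=` U -> f k @[k --> within U \oo] --> l ->
  f k @[k --> within K \oo] --> l.
Proof.
move=> KU; apply: cvg_trans; apply: cvg_app => A [N NN UA].
by exists N => // n Nn Kn; apply: UA => //; apply: KU.
Qed.

Lemma cvg_xcoord (F : set_system nat) (FF : Filter F) (f : nat -> 'cV[R]_2) l :
  f k @[k --> F] --> l -> xcoord (f k) @[k --> F] --> xcoord l.
Proof. by move=> fl; apply: cvg_comp fl _; exact: coord_continuous. Qed.

Lemma cvg_ycoord (F : set_system nat) (FF : Filter F) (f : nat -> 'cV[R]_2) l :
  f k @[k --> F] --> l -> ycoord (f k) @[k --> F] --> ycoord l.
Proof. by move=> fl; apply: cvg_comp fl _; exact: coord_continuous. Qed.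

Lemma side_closed (F : set_system nat) (FF : ProperFilter F) (J : symbol)
    (f : nat -> R) l :
  (\forall k \near F, match J with symL => f k <= 0 | symR => 0 <= f k end) ->
  f k @[k --> F] --> l ->
  match J with symL => l <= 0 | symR => 0 <= l end.
Proof.
by case: J => sgn fl; [apply: cvgr_to_le fl _ | apply: cvgr_to_ge fl _].
Qed.

(** A formula without case distinction, from which continuity is plain: the two
    halves differ by a multiple of the positive part of x. *)
Lemma bcmapE (p : bcnf R) (z : 'cV[R]_2) : bcmap p z = fhalf p symL z +
  ((xcoord z + `|xcoord z|) / 2) *:
  (Amx p symR *m mkpoint 1 0 - Amx p symL *m mkpoint 1 0).
Proof.
rewrite /bcmap; case: ltrP => [x0|x0].
  rewrite gtr0_norm // -mulr2n -[_ *+ 2]mulr_natr mulfK ?pnatr_eq0 //.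
  by rewrite !fhalfE scalerBr [RHS]addrC !addrA subrK.
by rewrite ler0_norm // subrr mul0r scale0r addr0.
Qed.

Lemma cvg_bcmap (p : bcnf R) (F : set_system nat) (FF : Filter F)
    (f : nat -> 'cV[R]_2) l :
  f k @[k --> F] --> l -> bcmap p (f k) @[k --> F] --> bcmap p l.
Proof.
move=> fl; rewrite bcmapE; under eq_cvg do rewrite bcmapE.
have xl := cvg_xcoord FF fl; have yl := cvg_ycoord FF fl.
apply: cvgD.
  rewrite fhalfE; under eq_cvg do rewrite fhalfE.
  apply: cvgD; last exact: cvg_cst.
  by apply: cvgD; apply: cvgZr_tmp.
apply: cvgZr_tmp; apply: cvgM; last exact: cvg_cst.
by apply: cvgD => //; exact: cvg_norm.
Qed.

End Limits.

Theorem theorem3p1 (R : realType) (p : bcnf R) (X Y : word)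
    (lambda1 lambda2 : R) (zeta1 zeta2 : 'cV[R]_2) :
  mu p != 0 ->
  (0 < size X)%N -> (0 < size Y)%N ->
  primitive X ->
  symbol_at X 0 <> symbol_at Y 0 ->
  infinite_set [set k : nat | (1 <= k)%N /\
    let S := XkY X Y k in
    [/\ has_unique_cycle p S,
        admissible S (cycle_of p S),
        lyapunov_stable p (cycle_of p S) &
        forall i : int, ~ switching_manifold (cycle_of p S i)]] ->
  eigenvalue (Mword p X) lambda1 ->
  eigenvalue (Mword p X) lambda2 ->
  0 <= lambda1 -> lambda1 < 1 -> 1 < lambda2 ->
  is_eigenvector (Mword p X) lambda1 zeta1 ->
  is_eigenvector (Mword p X) lambda2 zeta2 ->
  let Q := Qmx zeta1 zeta2 in
  let z0 := cycle_of p X 0 in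
  ~ parallel (of_uv Q z0 @` @v_axis R) (@switching_manifold R) ->
  [/\ gword p Q z0 Y @` @v_axis R `<=` @u_axis R,
      lambda1 != 0 /\ lambda2 = lambda1^-1 &
      admissible X (cycle_of p X) /\
      exists2 z : int -> 'cV[R]_2,
        homoclinic p z (cycle_of p X) & cycles_limit_to p X Y z].
Proof.
move=> _ X_gt0 Y_gt0 _ XY Kinf _ _ l1_ge0 l1_lt1 l2_gt1 z1P z2P Q z0 npar.
set K := (X in infinite_set X) in Kinf.
have l12 : lambda1 != lambda2.
  by rewrite lt_eqF // (lt_trans l1_lt1).
have [w wX] : exists w, fword p X w = w.
  apply: (fword_X_fixed_point 0 l12 z1P z2P).
  - by rewrite lt_eqF.
  - by rewrite gt_eqF.
have xP : is_cycle p X (cycle_of p X).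
  by apply: is_cycle_of; have [z zP _] := cycle_from_fixed X_gt0 wX; exists z.
have z0X : fword p X z0 = z0 := cycle_fixed xP.
have q2_neq0 := v_axis_not_vertical z2P npar.
(* K: the indices of the good cycles; U: those of the unique cycles. *)
pose U : set nat := [set k | has_unique_cycle p (XkY X Y k)].
have KU : K `<=` U by move=> k [_ []].
pose z k := cycle_of p (XkY X Y k).
have zP k : U k -> is_cycle p (XkY X Y k) (z k) by exact: unique_is_cycle.
pose u k := xcoord (to_uv Q z0 (z k 0)).
pose v k := ycoord (to_uv Q z0 (z k 0)).
have FK := infinite_within_proper Kinf.
have FKoo : within K \oo --> \oo by exact: cvg_within.
pose B := Ymx p Y zeta1 zeta2.
pose s := Yshift p Y zeta1 zeta2 z0.
have k_gt0 : \forall k \near within K \oo, (0 < k)%N.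
  by apply: near_within_all => k [].
have uvP k : U k ->
    u k = B ord0 ord0 * (lambda1 ^+ k * u k) +
          B ord0 ord_max * (lambda2 ^+ k * v k) + xcoord s /\
    v k = B ord_max ord0 * (lambda1 ^+ k * u k) +
          B ord_max ord_max * (lambda2 ^+ k * v k) + ycoord s.
  by move=> Uk; apply: (cycle_fixed_uv l12 z1P z2P z0X (zP k Uk)).
have fix_u : \forall k \near within K \oo,
    u k = B ord0 ord0 * (lambda1 ^+ k * u k) +
          B ord0 ord_max * (lambda2 ^+ k * v k) + xcoord s.
  by apply: near_within_all => k /KU/uvP[].
have fix_v : \forall k \near within K \oo,
    v k = B ord_max ord0 * (lambda1 ^+ k * u k) +
          B ord_max ord_max * (lambda2 ^+ k * v k) + ycoord s.
  by apply: near_within_all => k /KU/uvP[].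
have sidesK k : K k ->
    (xcoord z0 + xcoord zeta1 * (lambda1 ^+ k.-1 * u k)
       + xcoord zeta2 * (lambda2 ^+ k.-1 * v k)) *
    (xcoord z0 + xcoord zeta1 * (lambda1 ^+ k * u k)
       + xcoord zeta2 * (lambda2 ^+ k * v k)) < 0.
  move=> Kk; have [k0 [Uk adm _ nsw]] := Kk.
  rewrite -!xcoord_uv_point.
  have kpk : (k.-1 < k)%N by rewrite ltn_predL.
  have := cycle_block l12 z1P z2P z0X (zP k Uk) kpk (leq0n _).
  have := cycle_tail l12 z1P z2P z0X (zP k Uk) (leq0n _).
  rewrite !take0 /= !addn0 => <- eX; rewrite -[X in xcoord X * _]eX.
  have := nsw (k * size X)%N%:Z; have := nsw (k.-1 * size X)%N%:Z.
  have := adm (k * size X)%N%:Z; have := adm (k.-1 * size X)%N%:Z.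
  rewrite symbol_at_XkY_tail // -[(k.-1 * _)%N]addn0 symbol_at_XkY_block //.
  rewrite /switching_manifold /= -/(z k) addn0.
  case: (symbol_at X 0) (symbol_at Y 0) XY => -[] // _ xX xY /eqP nX /eqP nY.
    by rewrite nmulr_rlt0 lt_neqAle ?nX // xY andbT eq_sym.
  by rewrite pmulr_rlt0 lt_neqAle ?nY ?xY // xX andbT eq_sym.
have sides := near_within_all sidesK.
have bounded k : K k -> power_bounded (Mword p (XkY X Y k)).
  move=> [k0 [Uk adm stab nsw]].
  apply: (stable_power_bounded _ (zP k Uk) adm stab nsw).
  by rewrite size_XkY addn_gt0 Y_gt0 orbT.
have det_le1 : \forall k \near within K \oo,
  `|(B ord0 ord0 * B ord_max ord_max - B ord0 ord_max * B ord_max ord0)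
     * (lambda1 * lambda2) ^+ k| <= 1.
  apply: near_within_all => k /bounded/power_bounded_det.
  by rewrite (det_Mword_XkY Y l12 z1P z2P).
have tr_det : \forall k \near within K \oo,
  (B ord0 ord0 * lambda1 ^+ k + B ord_max ord_max * lambda2 ^+ k) ^+ 2 <=
  2 + 2 * ((B ord0 ord0 * B ord_max ord_max - B ord0 ord_max * B ord_max ord0)
     * (lambda1 * lambda2) ^+ k).
  apply: near_within_all => k /bounded/power_bounded_trace_det.
  by rewrite (det_Mword_XkY Y l12 z1P z2P) (trace_Mword_XkY Y l12 z1P z2P).
have s_neq0 : ycoord s = 0 -> xcoord s <> 0.
  move=> s20 s10; have [k Kk] := infinite_setN0 Kinf.
  have [k0 [Uk _ _ _]] := Kk.
  (* The base point of the X-cycle would be fixed by every f^(X^k Y), so by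
     uniqueness the cycle would start at u = v = 0. *)
  have z0Y : fword p Y z0 = z0.
    rewrite -[LHS](uv_pointK z0 l12 z1P z2P) -/Q -/s.
    by rewrite [xcoord _]s10 [ycoord _]s20 /uv_point !scale0r !addr0.
  have z0S : fword p (XkY X Y k) z0 = z0.
    rewrite fword_cat; have := fword_wpow_uv z1P z2P z0X k 0 0.
    by rewrite !mulr0 /uv_point !scale0r !addr0 => ->.
  have S_gt0 : (0 < size (XkY X Y k))%N by rewrite size_XkY addn_gt0 Y_gt0 orbT.
  have [y yP y0] := cycle_from_fixed S_gt0 z0S.
  have zk0 : z k 0 = z0 by rewrite -y0 /z (unique_cycle_eq Uk yP).
  have u0 : u k = 0 by rewrite /u zk0 /to_uv subrr mulmx0 /xcoord mxE.
  have v0 : v k = 0 by rewrite /v zk0 /to_uv subrr mulmx0 /ycoord mxE.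
  by have := sidesK k Kk; rewrite u0 v0 !mulr0 !addr0 -expr2 ltNge sqr_ge0.
have d0 : B ord_max ord_max = 0.
  exact: (d_eq0 FKoo l1_ge0 l1_lt1 l2_gt1 det_le1 tr_det).
have s20 : ycoord s = 0.
  exact: (s2_eq0 FKoo l1_ge0 l1_lt1 l2_gt1 q2_neq0 k_gt0 fix_u fix_v sides
    det_le1 tr_det).
have rho1 : lambda1 * lambda2 = 1.
  exact: (rho_eq1 FKoo l1_ge0 l1_lt1 l2_gt1 q2_neq0 k_gt0 fix_u fix_v sides
    det_le1 tr_det s_neq0).
have bc1 : 1 - B ord0 ord_max * B ord_max ord0 != 0.
  exact: (bc_neq1 FKoo l1_ge0 l1_lt1 l2_gt1 q2_neq0 k_gt0 fix_u fix_v sides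
    det_le1 tr_det s_neq0).
have l1_neq0 : lambda1 != 0.
  by apply/eqP => l10; have /eqP := rho1; rewrite l10 mul0r eq_sym oner_eq0.
split.
- move=> _ [y y0 <-].
  rewrite /u_axis /= (gword_Y Y z0 l12 z1P z2P) -/B -/s.
  by rewrite d0 s20 [xcoord y]y0 mul0r mulr0 !addr0.
- by split=> //; rewrite -[LHS]mul1r -(mulVf l1_neq0) -mulrA rho1 mulr1.
have FU : ProperFilter (within U \oo).
  by apply: infinite_within_proper; apply: sub_infinite_set KU Kinf.
have FUoo : within U \oo --> \oo by exact: cvg_within.
pose c := B ord_max ord0.
pose uoo := xcoord s / (1 - B ord0 ord_max * c).
have uoo_neq0 : uoo != 0.
  by rewrite mulf_neq0 ?invr_neq0 //; apply/eqP/s_neq0.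
have vE k : U k -> v k = c * (lambda1 ^+ k * u k).
  by move=> /uvP[_ ->]; rewrite d0 s20 mul0r !addr0.
have u_cvg : u k @[k --> within U \oo] --> uoo.
  pose E k := 1 - B ord0 ord0 * lambda1 ^+ k - B ord0 ord_max * c.
  apply: (@cvg_quotient _ _ FU _ E) => //.
    apply: near_within_all => k Uk; have [uk _] := uvP k Uk.
    have l2vk : lambda2 ^+ k * v k = c * u k.
      rewrite vE // mulrCA (mulrA (lambda2 ^+ k)) -exprMn (mulrC lambda2) rho1.
      by rewrite expr1n mul1r.
    by rewrite l2vk in uk; rewrite /E; move: uk; set uk := u k; lra.
  have cvg_l1 := cvg_expr_along FUoo l1_ge0 l1_lt1.
  have -> : 1 - B ord0 ord_max * c =
      1 - B ord0 ord0 * 0 - B ord0 ord_max * c by rewrite mulr0 subr0.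
  by rewrite /E; solve_cvg.
pose orb := limit_orbit p X Y lambda1 zeta1 zeta2 z0 uoo (c * uoo).
have lim i : z k ((k * size X)%N%:Z + i) @[k --> within U \oo] --> orb i.
  apply: (cvg_limit_orbit l12 z1P z2P z0X X_gt0 l1_ge0 l1_lt1 rho1 FUoo) => //.
  - exact: near_within_all.
  - exact: near_within_all.
have adm : admissible X (cycle_of p X).
  apply: (@admissible_from_prefix R p X z0 X_gt0 _ xP erefl) => r rX.
  (* The sign passes to the limit twice: in k for the q-th traversal of X by the
     limit orbit, then in q. *)
  apply: (@side_closed R \oo _ _ (fun q => xcoord (fword p (take r X)
    (uv_point zeta1 zeta2 z0 (lambda1 ^+ q * uoo) 0)))); last first.
    apply: cvg_xcoord.
    rewrite [X in _ --> fword _ _ X](_ : z0 = uv_point zeta1 zeta2 z0 0 0);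
      last by rewrite /uv_point !scale0r !addr0.
    apply: cvg_fword_uv; last exact: cvg_cst.
    rewrite -(mul0r uoo); apply: cvgM; last exact: cvg_cst.
    by apply: (@cvg_expr R); rewrite ger0_norm.
  apply: filterE => q; apply: (@side_closed R (within K \oo) _ _
    (fun k => xcoord (z k (q * size X + r)%N%:Z))); last first.
    apply: cvg_xcoord.
    apply: (cvg_forward l12 z1P z2P z0X l1_ge0 l1_lt1 FKoo (c := c)) => //.
    - by apply: near_within_all => k /KU; exact: zP.
    - exact: (cvg_within_sub KU u_cvg).
    - by apply: near_within_all => k /KU; exact: vE.
    - exact: ltnW.
  near=> k; have qk : (q < k)%N by near: k; exact: FKoo (nbhs_infty_gt q).
  have [_ [_ admk _ _]] : K k by near: k; exact: near_within_all.
  by have := admk (q * size X + r)%N%:Z; rewrite symbol_at_XkY_block.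
have orbP : is_orbit p orb.
  move=> i; have lim_i := cvg_within_sub KU (lim i).
  have lim_i1 := cvg_within_sub KU (lim (i + 1)).
  apply: (cvg_unique (@norm_hausdorff _ _) lim_i1).
  have lim_b : bcmap p (z k ((k * size X)%N%:Z + i)) @[k --> within K \oo]
      --> bcmap p (orb i) by apply: cvg_bcmap lim_i.
  move: lim_b; apply: cvg_trans; apply: near_eq_cvg.
  apply: near_within_all => k Kk; have [_ [Uk admk _ _]] := Kk.
  rewrite addrA (zP k Uk).2.
  by rewrite (@bcmap_fhalf _ p _ _ (admk ((k * size X)%N%:Z + i))).
split=> //; exists orb; last exact: lim.
split=> //.
- exact: (limit_orbit_not_in_cycle l12 z1P z2P X_gt0 l1_lt1 xP uoo_neq0).
- exact: limit_orbit_forward.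
- exact: limit_orbit_backward.
Unshelve. all: by end_near.
Qed.
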